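(* Let $(X,d,\mu)$ be as in the context, fix $x\in X$ and $0<R_0<\frac14\operatorname{diam}X$, write $B_r=B(x,r)$, let $1<p<\infty$, and assume that $\mu$ is globally doubling and that $X$ supports a global $p_0$-Poincaré inequality for some $1\le p_0<p$. (i) If $p=\max\underline{Q}_0(x)$ and $0<2r\le R\le R_0$, then $\frac{\mu(B_r)}{r^p}\big(\log\frac Rr\big)^{1-p}\lesssim\operatorname{cap}_p(B_r,B_R)\lesssim\frac{\mu(B_R)}{R^p}\big(\log\frac Rr\big)^{1-p}$. (ii) If $p=\min\overline{Q}_0(x)$ and $0<2r\le R\le R_0$, then $\frac{\mu(B_R)}{R^p}\big(\log\frac Rr\big)^{1-p}\lesssim\operatorname{cap}_p(B_r,B_R)\lesssim\frac{\mu(B_r)}{r^p}\big(\log\frac Rr\big)^{1-p}$. Moreover, if the lower bound in (i) holds for all $0<2r\le R\le R_0$, then $p\le\sup\underline{Q}_0(x)$, and if the lower bound in (ii) holds for all $0<2r\le R\le R_0$, then $p\ge\inf\overline{Q}_0(x)$.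
   Context: $(X,d,\mu)$ is a metric space with a positive complete Borel measure $\mu$ such that $0<\mu(B)<\infty$ for every ball $B$. $\mu$ is globally doubling if there is $C$ with $\mu(B(y,2r))\le C\mu(B(y,r))$ for all $y$, $r>0$. Upper gradients: a nonnegative Borel $g$ with $|f(\gamma(0))-f(\gamma(l_\gamma))|\le\int_\gamma g\,ds$ for all nonconstant compact rectifiable curves; $p$-weak upper gradients: same for all curves outside a family of zero $p$-modulus; $g_u$ is the minimal $p$-weak upper gradient. $N^{1,p}(X)$: everywhere-defined measurable $f$ with $\int|f|^p\,d\mu+\inf_g\int g^p\,d\mu<\infty$; $N^{1,p}_0(\Omega)=\{f|_\Omega: f\in N^{1,p}(X), f=0\text{ on }X\setminus\Omega\}$; $\operatorname{cap}_p(E,\Omega)=\inf\{\int_\Omega g_u^p\,d\mu: u\in N^{1,p}_0(\Omega),\ u\ge1\text{ on }E\}$. A global $p_0$-Poincaré inequality: there are $C,\lambda\ge1$ with $\frac1{\mu(B)}\int_B|f-f_B|\,d\mu\le Cr\big(\frac1{\mu(\lambda B)}\int_{\lambda B}g^{p_0}\,d\mu\big)^{1/p_0}$ for all balls $B$ of radius $r$, integrable $f$ and upper gradients $g$ of $f$. $\underline{Q}_0(x)=\{q>0:\exists C_q,\ \mu(B_r)/\mu(B_R)\le C_q(r/R)^q\text{ for }0<r<R\le1\}$, $\overline{Q}_0(x)=\{q>0:\exists C_q,\ \mu(B_r)/\mu(B_R)\ge C_q(r/R)^q\text{ for }0<r<R\le1\}$. $a\lesssim b$ means $a\le Cb$ with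 $C$ independent of $r,R$ (possibly depending on $R_0$, $p$, $x$ and the data). *)

(* Defs.v *)
From HB Require Import structures.
From mathcomp Require Import all_boot all_order all_algebra.
From mathcomp Require Import all_classical all_reals all_analysis.
From mathcomp Require Export measurable_realfun.
Set Implicit Arguments. Unset Strict Implicit. Unset Printing Implicit Defensive.
Import Order.TTheory GRing.Theory Num.Theory.
Import numFieldNormedType.Exports.
Local Open Scope classical_set_scope.
Local Open Scope ring_scope.

Section MetricDefs.
Context {R : realType} {X : Type}.
Variable d : X -> X -> R.

Definition is_metric :=
  [/\ (forall x y, 0 <= d x y), (forall x y, d x y = 0 <-> x = y),
      (forall x y, d x y = d y x) & (forall x y z, d x z <= d x y + d y z)].

Definition dball (y : X) (r : R) : set X := [set z | d y z < r].

Definition d_open (U : set X) :=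
  forall y, U y -> exists2 e : R, 0 < e & dball y e `<=` U.

Definition d_borel : set (set X) := <<s d_open >>.

Definition borel_efun (g : X -> \bar R) :=
  forall A : set (\bar R), measurable A -> d_borel (g @^-1` A).

Definition diam : \bar R := ereal_sup [set e | exists y z, e = (d y z)%:E].

Definition curve_length (g : R -> X) (a b : R) : \bar R :=
  ereal_sup [set e | exists (n : nat) (t : nat -> R),
    [/\ t 0%N = a, t n = b, (forall i, (i < n)%N -> t i <= t i.+1) &
        e = (\sum_(i < n) d (g (t i)) (g (t i.+1)))%:E]].

(* A compact curve is a pair (gamma, l) with gamma defined on [0, l].
   It is arc-length parametrized if the length of gamma|[a,b] is b - a. *)
Definition arc_length (c : (R -> X) * R) :=
  forall a b, 0 <= a -> a <= b -> b <= c.2 -> curve_length c.1 a b = (b - a)%:E.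

(* nonconstant compact rectifiable curves, in arc-length parametrization *)
Definition curves : set ((R -> X) * R) := [set c | arc_length c /\ 0 < c.2].

Definition line_int (g : X -> \bar R) (c : (R -> X) * R) : \bar R :=
  (\int[@lebesgue_measure R]_(t in [set t : R | (0 <= t <= c.2)%R]) g (c.1 t))%E.

Definition ug_ineq (f : X -> R) (g : X -> \bar R) (c : (R -> X) * R) :=
  ((`|f (c.1 0) - f (c.1 c.2)|)%:E <= line_int g c)%E.

Definition upper_gradient (f : X -> R) (g : X -> \bar R) :=
  [/\ borel_efun g, (forall y, (0 <= g y)%E) & forall c, curves c -> ug_ineq f g c].

End MetricDefs.

Section MeasureDefs.
Context {R : realType} {dsp : measure_display} {X : measurableType dsp}.
Variables (d : X -> X -> R) (mu : {measure set X -> \bar R}).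
Local Open Scope ereal_scope.

Definition modulus (p : R) (G : set ((R -> X) * R)) : \bar R :=
  ereal_inf [set \int[mu]_(y in setT) (rho y `^ p) | rho in
    [set rho : X -> \bar R | [/\ borel_efun d rho, (forall y, 0 <= rho y) &
       forall c, G c -> 1 <= line_int rho c]]].

Definition pweak_upper_gradient (p : R) (f : X -> R) (g : X -> \bar R) :=
  [/\ borel_efun d g, (forall y, 0 <= g y) &
      modulus p [set c | curves d c /\ ~ ug_ineq f g c] = 0].

Definition newtonian (p : R) (f : X -> R) :=
  [/\ measurable_fun setT f,
      \int[mu]_(y in setT) ((`|f y|)%:E `^ p) < +oo &
      exists g, upper_gradient d f g /\ \int[mu]_(y in setT) (g y `^ p) < +oo].

Definition capacity (p : R) (E Omega : set X) : \bar R :=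
  ereal_inf [set \int[mu]_(y in Omega) (ug.2 y `^ p) | ug in
    [set ug : (X -> R) * (X -> \bar R) |
       [/\ newtonian p ug.1, (forall y, ~ Omega y -> ug.1 y = 0%R),
           (forall y, E y -> (1 <= ug.1 y)%R) & pweak_upper_gradient p ug.1 ug.2]]].

Definition globally_doubling :=
  exists C : R, forall y (r : R), (0 < r)%R ->
    mu (dball d y (2 * r)) <= C%:E * mu (dball d y r).

Definition global_poincare (p0 : R) :=
  exists C lam : R, [/\ (1 <= C)%R, (1 <= lam)%R &
    forall (y : X) (r : R) (f : X -> R) (g : X -> \bar R), (0 < r)%R ->
      mu.-integrable setT (EFin \o f) -> upper_gradient d f g ->
      let B := dball d y r in
      let mB := fine (mu B) in
      let fB := (fine (\int[mu]_(z in B) (f z)%:E) / mB)%R in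
      \int[mu]_(z in B) (`|f z - fB|)%:E <=
        (C * r * mB)%:E *
        ((((fine (mu (dball d y (lam * r))))^-1)%:E *
          \int[mu]_(z in dball d y (lam * r)) (g z `^ p0)) `^ p0^-1)].

Definition Qlow (x : X) : set R :=
  [set q | (0 < q)%R /\ exists C : R, (0 < C)%R /\ forall r R' : R,
     (0 < r)%R -> (r < R')%R -> (R' <= 1)%R ->
     (fine (mu (dball d x r)) / fine (mu (dball d x R')) <= C * (r / R') `^ q)%R].

Definition Qup (x : X) : set R :=
  [set q | (0 < q)%R /\ exists C : R, (0 < C)%R /\ forall r R' : R,
     (0 < r)%R -> (r < R')%R -> (R' <= 1)%R ->
     (C * (r / R') `^ q <= fine (mu (dball d x r)) / fine (mu (dball d x R')))%R].

End MeasureDefs.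

(* Main.v *)
Require Import Defs.
From HB Require Import structures.
From mathcomp Require Import all_boot all_order all_algebra.
From mathcomp Require Import all_classical all_reals all_analysis measurable_realfun.
From mathcomp Require Import ring lra zify.
Import Order.TTheory GRing.Theory Num.Theory.
Import numFieldNormedType.Exports.
Local Open Scope classical_set_scope.
Local Open Scope ring_scope.

(** Lower bounds.  Let [u] be a test function truncated to [0, 1] and [h] an
upper gradient of [u] vanishing off [B_R].  The Poincare inequality first gives
connectivity, hence reverse doubling, so the averages of [u] over [B_r] and over
a large concentric ball differ by a fixed amount.  Telescoping over the balls
[B^n] of radius [Lam^n r] bounds that amount by the sum of
[Lam^n r (mu(B^n)^-1 int_{B^(n+1)} h^p0)^(1/p0)].  Since [p0 < p], the numbers
[s_n = (int_{B^n} h^p0)^(1/p0) mu(B^n)^(1/p - 1/p0)] satisfy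
[s_(n+1) <= tau s_n + 2 (int_{B^(n+1) \ B^n} h^p)^(1/p)] with [tau < 1] by reverse
doubling, so only the annuli contribute and Hoelder's inequality over the
[O(log(R/r))] scales yields the exponent [1 - p] of the logarithm.

Upper bounds.  The average of the dyadic tent functions
[min(1, 2 - d(x, .)/(2^j r))_+], [2^(j+1) r <= R], is a test function for which
the energy is a sum of [O(log(R/r))] comparable terms.

Converses.  One tent function bounds the capacity by [mu(B_R)/R^p] and by
[mu(B_r)/r^p], and [log(R/r)^(p-1)] is absorbed by any positive power of [R/r]. *)

(** * Curves and cutting off upper gradients *)

(** The Poincare inequality asks for genuine upper gradients and integrates over dilated balls,
    whereas the capacity admits weak ones and integrates over [B_R] only. Two devices bridge this:
    an admissible density of small energy is added to the gradient to serve the exceptional curves,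
    and an upper gradient of a nonnegative function that vanishes off an open set may be replaced by
    zero off that set.

    The strict inequality p0 < p is what produces the exponent of the logarithm. With p in its place
    each scale would carry the energy of a whole ball, and N scales would cost a factor N instead of
    N^(1 - 1/p). The gap 1/p0 - 1/p makes the contribution of the smaller balls decay geometrically.

    Parts (i) and (ii) are one estimate, in which mu(B_rho)/rho^p is bounded from both sides for rho
    in [r, R]; membership of p in either exponent set is almost monotonicity of this quotient, in
    opposite directions. Hoelder's inequality is obtained from a pointwise Young inequality with a
    free parameter, which survives infinite values and explains the factors 2. *)

Section Curves.
Context {R : realType} {X : pointedType} (d : X -> X -> R).
Local Notation leb := (@lebesgue_measure R).

Lemma curve_lip (c : (R -> X) * R) a b : curves d c ->
  0 <= a -> a <= b -> b <= c.2 -> d (c.1 a) (c.1 b) <= b - a.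
Proof.
move=> [cl _] a0 ab bl; rewrite -lee_fin -(cl a b)//.
apply: ereal_sup_ubound; exists 1%N, (fun i => if i == 0%N then a else b).
by split => // [[|]//|]; rewrite big_ord1.
Qed.

Lemma curve_prefix (c : (R -> X) * R) t : curves d c -> 0 < t -> t <= c.2 ->
  curves d (c.1, t).
Proof.
move=> [cl _] t0 tl; split => // a b a0 ab bt.
by apply: cl => //; exact: le_trans bt tl.
Qed.

Lemma curve_suffix (c : (R -> X) * R) t : curves d c -> 0 <= t -> t < c.2 ->
  curves d (fun s => c.1 (s + t), c.2 - t).
Proof.
move=> [cl _] t0 tl; split => /=; last by rewrite subr_gt0.
move=> a b a0 ab; rewrite /= lerBrDr => bt.
rewrite (_ : b - a = (b + t) - (a + t)); last by ring.
rewrite -(cl (a + t) (b + t)) ?lerD2r ?addr_ge0//.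
congr ereal_sup; apply/seteqP; split => _ /= [n [s [s0 sn sm ->]]].
- exists n, (fun i => s i + t); split; rewrite ?s0 ?sn// => i /sm.
  by rewrite lerD2r.
- exists n, (fun i => s i - t); split; rewrite ?s0 ?sn ?addrK//.
  + by move=> i /sm; rewrite lerD2r.
  + by under [in RHS]eq_bigr do rewrite !subrK.
Qed.

(** Gives access to the general measurability lemmas. The Borel sigma-algebra of [d] is kept apart
    from the one that carries the measure, which may be larger. *)
Lemma d_borelP (g : X -> \bar R) : borel_efun d g <->
  measurable_fun setT (g : g_sigma_algebraType (d_open d) -> \bar R).
Proof.
split => [bg _ A mA|mg A mA]; first by rewrite setTI; exact: bg.
by rewrite -[_ @^-1` _]setTI; exact: mg.
Qed.

Lemma d_open_borel U : d_open d U ->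
  measurable (U : set (g_sigma_algebraType (d_open d))).
Proof. by move=> oU; apply: sub_sigma_algebra. Qed.

Lemma borel_restrict g U : d_open d U -> borel_efun d g ->
  borel_efun d (g \_ U).
Proof.
move=> oU /d_borelP bg; apply/d_borelP.
apply: (iffLR (measurable_restrictT (T1 := g_sigma_algebraType (d_open d)) _ _)).
  exact: d_open_borel.
exact: measurable_funTS.
Qed.

Hypothesis dm : is_metric d.

Lemma dball_open x r : d_open d (dball d x r).
Proof.
case: dm => _ _ _ dt; move=> y; rewrite /dball/= => yr.
exists (r - d x y); first by rewrite subr_gt0.
by move=> z /=; rewrite ltrBrDl; apply: le_lt_trans.
Qed.

Lemma borel_comp_curve g (c : (R -> X) * R) : borel_efun d g -> curves d c ->
  measurable_fun `[0, c.2] (g \o c.1).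
Proof.
move=> bg cc _ A mA; rewrite comp_preimage.
(* The sets whose preimage in [[0, c.2]] is measurable form a sigma-algebra, so open sets suffice;
   for these the curve is 1-Lipschitz. *)
suff : d_borel d `<=` image_set_system `[0, c.2] c.1 measurable.
  by apply; exact: bg.
apply: smallest_sub.
  have -> : image_set_system `[0, c.2] c.1 measurable =
     image_set_system `[0, c.2] c.1 [set A | measurable A /\ A `<=` `[0, c.2]].
    apply/seteqP; split => B /=; rewrite /image_set_system/=; last by case.
    by split => // t [].
  apply: sigma_algebra_image; split.
  - by split; [exact: measurable0|exact: sub0set].
  - move=> B [mB sB]; split; first exact: measurableD.
    by move=> t [].
  - move=> F mF; split; first by apply: bigcupT_measurable => i; case: (mF i).
    by move=> t [i _]; case: (mF i) => _; apply.
move=> U oU; rewrite /image_set_system/=.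
have l0 : 0 < c.2 by case: cc.
(* The curve is controlled on [[0, c.2]] only, so the preimage of [U] is merely relatively open. [W]
   is an open subset of the line with the same trace on the interval. *)
pose W := \bigcup_(te in [set te : R * R | [/\ 0 <= te.1 <= c.2, 0 < te.2 &
   forall s, 0 <= s <= c.2 -> `|te.1 - s| < te.2 -> U (c.1 s)]]) ball te.1 te.2.
have -> : `[0, c.2] `&` c.1 @^-1` U = `[0, c.2] `&` W.
  apply/seteqP; split => t /= []; rewrite in_itv/= => tl.
    move=> Ut; split => //; have [e e0 eU] := oU _ Ut.
    exists (t, e); last by rewrite /ball/= subrr normr0.
    split => //= s sl ts; apply: eU; rewrite /dball/=.
    have [st|st] := leP s t.
      case: dm => _ _ ds _; rewrite ds; apply: le_lt_trans ts.
      case/andP: sl => s0 _; case/andP: tl => _ tl.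
      by rewrite ger0_norm ?subr_ge0// curve_lip.
    apply: le_lt_trans ts.
    case/andP: sl => _ s0; case/andP: tl => tl _.
    by rewrite distrC ger0_norm ?subr_ge0// ?curve_lip ?(ltW st).
  by move=> [[s e] /= [sl e0 H] te]; split => //; exact: H.
apply: measurableI => //; apply: open_measurable; apply: bigcup_open.
by move=> [s e] _; exact: ball_open.
Qed.

Lemma lebesgue_measure_shift (t : R) (A : set R) : measurable A ->
  pushforward leb ((+%R^~ t) : _ -> measurableTypeR R) A = leb A.
Proof.
move=> mA; apply: esym; apply: lebesgue_measure_unique => //.
  exact: (@measurable_funD _ _ _ _ id (cst t)).
move=> _ _ [[a b] _ <-] /=; rewrite /pushforward.
rewrite (_ : _ @^-1` _ = `]a - t, b - t]%classic); last first.
  by apply/seteqP; split => x /=; rewrite !in_itv/= ltrBlDr lerBrDr.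
rewrite !lebesgue_measure_itv/= !lte_fin ltrD2r; case: ifPn => // _.
by rewrite -!EFinB; congr EFin; ring.
Qed.

Lemma line_intE g (c : (R -> X) * R) :
  line_int g c = (\int[leb]_(t in `[0%R, c.2]) g (c.1 t))%E.
Proof. by rewrite /line_int set_itvcc. Qed.

Lemma line_int_suffix g (c : (R -> X) * R) t : borel_efun d g ->
  (forall y, (0 <= g y)%E) ->
  curves d c -> 0 <= t -> t < c.2 ->
  line_int g (fun s => c.1 (s + t), c.2 - t) =
  (\int[leb]_(s in `[t, c.2]) g (c.1 s))%E.
Proof.
move=> bg g0 cc t0 tl; rewrite line_intE/=.
have mg : measurable_fun `[t, c.2] (g \o c.1).
  apply: measurable_funS (borel_comp_curve _ _ bg cc) => //.
  by apply: subset_itvr; rewrite bnd_simp.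
rewrite (_ : `[0, c.2 - t]%classic =
   ((+%R^~ t) : _ -> measurableTypeR R) @^-1` `[t, c.2]); last first.
  by apply/seteqP; split => s /=; rewrite !in_itv/= lerBrDr lerDr.
have ms : measurable_fun setT ((+%R^~ t) : measurableTypeR R -> measurableTypeR R).
  exact: (@measurable_funD _ _ _ _ id (cst t)).
rewrite -(@ge0_integral_pushforward _ _ _ (measurableTypeR R) _ _ ms leb _ (g \o c.1))//=.
unshelve eapply (@eq_measure_integral _ (measurableTypeR R) _ _ leb
  (pushforward leb ((+%R^~ t) : _ -> measurableTypeR R))).
  exact: ms.
by move=> A mA AS; exact: lebesgue_measure_shift.
Qed.

(* The exit time of the curve from Om is attained since Om is open, and u
   vanishes there; so only the part of the curve before it matters. *)
Lemma ug_cutoff_prefix u g Om (c : (R -> X) * R) : d_open d Om ->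
  (forall y, ~ Om y -> u y = 0) -> upper_gradient d u g -> curves d c ->
  (exists2 t, 0 <= t <= c.2 & ~ Om (c.1 t)) ->
  (`|u (c.1 0%R)|%:E <= line_int (g \_ Om) c)%E.
Proof.
move=> oU u0 [bg g0 ug] cc [t /andP[t0 tl] Ut].
pose S := [set t : R | 0 <= t <= c.2 /\ ~ Om (c.1 t)].
have S0 : S !=set0 by exists t; split => //; rewrite t0.
have Slb : lbound S 0 by move=> s [/andP[]].
have hS : has_inf S by split => //; exists 0.
pose s := inf S.
have s0 : 0 <= s by apply: lb_le_inf.
have sl : s <= c.2.
  by apply: le_trans (_ : t <= _) => //; apply: ge_inf; [exists 0|split; rewrite ?t0].
have before r : 0 <= r -> r < s -> Om (c.1 r).
  move=> r0 rs; apply: contrapT => Ur.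
  suff : s <= r by rewrite leNgt rs.
  apply: ge_inf; first by exists 0.
  by split => //; rewrite r0/= (le_trans (ltW rs)).
have sU : ~ Om (c.1 s).
  move=> /oU[e e0 eU]; have [r [/andP[r0 rl] Ur]] := inf_adherent e0 hS.
  rewrite -/s => rse; have sr : s <= r.
    by apply: ge_inf; [exists 0|split; rewrite ?r0].
  apply: Ur; apply: eU; rewrite /dball/=.
  by apply: le_lt_trans (curve_lip _ _ _ cc _ _ _) _ => //; rewrite ltrBlDl.
have mgU : measurable_fun `[0, c.2] ((g \_ Om) \o c.1).
  by apply: borel_comp_curve => //; exact: borel_restrict.
have gU0 y : (0 <= (g \_ Om) y)%E by apply: erestrict_ge0.
(* If the exit time is 0, the initial piece is constant and does not belong to [curves]; but then
   [u] vanishes at the starting point. *)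
have [s00|s00] := eqVneq s 0.
  rewrite -s00 u0// normr0 line_intE; exact: integral_ge0.
have sp : 0 < s by rewrite lt_neqAle eq_sym s00.
have /ug : curves d (c.1, s) by exact: curve_prefix.
rewrite /ug_ineq/= (u0 _ sU) subr0 => /le_trans; apply.
rewrite !line_intE/=.
apply: (@le_trans _ _ (\int[leb]_(t in `[0%R, s]) (g \_ Om) (c.1 t))%E).
  (* The endpoint [s] is dropped because the curve is outside [Om] there and the two integrands may
     differ. *)
  rewrite -!integral_itv_bndo_bndc; last 2 first.
  - apply: measurable_funS mgU => // r/=; rewrite !in_itv/= => /andP[-> /ltW].
    by move=> /le_trans; apply.
  - apply: measurable_funS (borel_comp_curve _ _ bg cc) => // r/=.
    by rewrite !in_itv/= => /andP[-> /ltW]; move=> /le_trans; apply.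
  rewrite le_eqVlt; apply/orP; left; apply/eqP; apply: eq_integral => r.
  by rewrite inE/= in_itv/= => /andP[r0 rs]; rewrite patchT// inE; exact: before.
apply: ge0_subset_integral => //.
by apply: subset_itvl; rewrite bnd_simp.
Qed.

(** The mirror image at the last time the curve lies outside [Om]; the final piece is shifted so
    that it starts at parameter 0. *)
Lemma ug_cutoff_suffix u g Om (c : (R -> X) * R) : d_open d Om ->
  (forall y, ~ Om y -> u y = 0) -> upper_gradient d u g -> curves d c ->
  (exists2 t, 0 <= t <= c.2 & ~ Om (c.1 t)) ->
  (`|u (c.1 c.2)|%:E <= line_int (g \_ Om) c)%E.
Proof.
move=> oU u0 [bg g0 ug] cc [t /andP[t0 tl] Ut].
pose S := [set t : R | 0 <= t <= c.2 /\ ~ Om (c.1 t)].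
have S0 : S !=set0 by exists t; split => //; rewrite t0.
have Sub : ubound S c.2 by move=> s [/andP[]].
have hS : has_sup S by split => //; exists c.2.
pose s := sup S.
have sl : s <= c.2 by apply: ge_sup.
have s0 : 0 <= s.
  by apply: le_trans (_ : t <= _) => //; apply: ub_le_sup; [exists c.2|split; rewrite ?t0].
have after r : s < r -> r <= c.2 -> Om (c.1 r).
  move=> rs r0; apply: contrapT => Ur.
  suff : r <= s by rewrite leNgt rs.
  apply: ub_le_sup; first by exists c.2.
  by split => //; rewrite r0/= (le_trans _ (ltW rs)).
have sU : ~ Om (c.1 s).
  move=> /oU[e e0 eU]; have [r [/andP[r0 rl] Ur]] := sup_adherent e0 hS.
  rewrite -/s => rse; have sr : r <= s.
    by apply: ub_le_sup; [exists c.2|split; rewrite ?r0].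
  apply: Ur; apply: eU; rewrite /dball/=; case: dm => _ _ -> _.
  apply: le_lt_trans (curve_lip _ _ _ cc _ _ _) _ => //.
  by rewrite ltrBlDr -ltrBlDl.
have mgU : measurable_fun `[0, c.2] ((g \_ Om) \o c.1).
  by apply: borel_comp_curve => //; exact: borel_restrict.
have gU0 y : (0 <= (g \_ Om) y)%E by apply: erestrict_ge0.
have [s00|s00] := eqVneq s c.2.
  rewrite -s00 u0// normr0 line_intE; exact: integral_ge0.
have sp : s < c.2 by rewrite lt_neqAle s00.
have /ug : curves d (fun r => c.1 (r + s), c.2 - s) by exact: curve_suffix.
rewrite /ug_ineq/= add0r subrK (u0 _ sU) sub0r normrN => /le_trans; apply.
rewrite line_int_suffix// line_intE/=.
apply: (@le_trans _ _ (\int[leb]_(t in `[s, c.2]) (g \_ Om) (c.1 t))%E).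
  rewrite -!integral_itv_obnd_cbnd; last 2 first.
  - apply: measurable_funS mgU => // r/=; rewrite !in_itv/= => /andP[/ltW h ->].
    by rewrite (le_trans _ h).
  - apply: measurable_funS (borel_comp_curve _ _ bg cc) => // r/=.
    by rewrite !in_itv/= => /andP[/ltW h ->]; rewrite (le_trans _ h).
  rewrite le_eqVlt; apply/orP; left; apply/eqP; apply: eq_integral => r.
  by rewrite inE/= in_itv/= => /andP[r0 rs]; rewrite patchT// inE; exact: after.
apply: ge0_subset_integral => //.
by apply: subset_itvr; rewrite bnd_simp.
Qed.

(** A curve that leaves [Om] bounds both end values separately, and by nonnegativity their
    difference is at most the larger one. Along a curve that stays in [Om] the gradient is
    unchanged. *)
Lemma upper_gradient_cutoff u g Om : d_open d Om -> (forall y, 0 <= u y) ->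
  (forall y, ~ Om y -> u y = 0) -> upper_gradient d u g ->
  upper_gradient d u (g \_ Om).
Proof.
move=> oU up u0 ugg; have [bg g0 ug] := ugg; split.
- exact: borel_restrict.
- by move=> y; exact: erestrict_ge0.
move=> c cc; have [ex|nex] := pselect (exists2 t, 0 <= t <= c.2 & ~ Om (c.1 t)).
  have h1 := ug_cutoff_prefix _ _ _ _ oU u0 ugg cc ex.
  have h2 := ug_cutoff_suffix _ _ _ _ oU u0 ugg cc ex.
  rewrite /ug_ineq; have [h|h] := leP (u (c.1 0)) (u (c.1 c.2)).
    apply: le_trans h2; rewrite lee_fin ler0_norm ?subr_le0// ger0_norm//.
    by rewrite opprB gerBl.
  apply: le_trans h1; rewrite lee_fin.
  by rewrite !ger0_norm ?subr_ge0 ?(ltW h)// gerBl.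
rewrite /ug_ineq; have := ug _ cc; rewrite /ug_ineq => /le_trans; apply.
rewrite !line_intE; rewrite le_eqVlt; apply/orP; left; apply/eqP.
apply: eq_integral => t; rewrite inE/= in_itv/= => tl; rewrite patchT// inE.
by apply: contrapT => Ut; apply: nex; exists t.
Qed.

End Curves.

(** * Upper bounds for the capacity *)

Section UpperBound.
Context {R : realType} {dsp : measure_display} {X : measurableType dsp}.
Variables (d : X -> X -> R) (mu : {measure set X -> \bar R}).
Hypothesis dm : is_metric d.
Hypothesis mopen : forall U : set X, d_open d U -> measurable U.

Lemma borel_measurable_fun (g : X -> \bar R) : borel_efun d g ->
  measurable_fun setT g.
Proof.
move=> bg _ A mA; rewrite setTI.
have : d_borel d (g @^-1` A) by exact: bg.
apply: (smallest_sub (sigma_algebra_measurable X)); exact: mopen.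
Qed.

Lemma dball_measurable x r : measurable (dball d x r).
Proof. by apply: mopen; exact: dball_open. Qed.

Lemma upper_gradient_cst (f : X -> R) (L : R) : 0 <= L ->
  (forall y z, `|f y - f z| <= L * d y z) ->
  upper_gradient d f (cst L%:E).
Proof.
move=> L0 fL; split => //.
- by apply/d_borelP; exact: measurable_cst.
- move=> c cc; rewrite /ug_ineq line_intE/= integral_cst//= lebesgue_measure_itv/=.
  have l0 : 0 < c.2 by case: cc.
  rewrite lte_fin l0 oppr0 addr0 -EFinM lee_fin.
  apply: (le_trans (fL _ _)); rewrite ler_wpM2l//.
  by rewrite -[leRHS]subr0; apply: curve_lip => //; exact: ltW.
Qed.

Lemma upper_gradientD (f1 f2 : X -> R) (g1 g2 : X -> \bar R) :
  upper_gradient d f1 g1 -> upper_gradient d f2 g2 ->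
  upper_gradient d (f1 \+ f2) (g1 \+ g2)%E.
Proof.
move=> [b1 p1 u1] [b2 p2 u2]; split.
- by apply/d_borelP; apply: emeasurable_funD; exact/d_borelP.
- by move=> y; exact: adde_ge0.
- move=> c cc; rewrite /ug_ineq line_intE ge0_integralD//; last 2 first.
    exact: (borel_comp_curve _ dm _ _ b1 cc).
    exact: (borel_comp_curve _ dm _ _ b2 cc).
  have := leeD (u1 _ cc) (u2 _ cc); rewrite !line_intE; apply: le_trans.
  by rewrite -EFinD lee_fin /= opprD addrACA ler_normD.
Qed.

Lemma upper_gradientZ (f : X -> R) (g : X -> \bar R) (k : R) : 0 <= k ->
  upper_gradient d f g ->
  upper_gradient d (fun y => k * f y) (fun y => k%:E * g y)%E.
Proof.
move=> k0 [b p u]; split.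
- by apply/d_borelP; apply: measurable_funeM; exact/d_borelP.
- by move=> y; apply: mule_ge0.
- move=> c cc; rewrite /ug_ineq line_intE ge0_integralZl_EFin//; last first.
    exact: (borel_comp_curve _ dm _ _ b cc).
  rewrite -line_intE -mulrBr normrM ger0_norm// EFinM; apply: lee_wpmul2l => //.
  exact: u.
Qed.

Lemma upper_gradient_sum (f : nat -> X -> R) (g : nat -> X -> \bar R) n :
  (forall i, upper_gradient d (f i) (g i)) ->
  upper_gradient d (fun y => \sum_(i < n) f i y)
    (fun y => \sum_(i < n) g i y)%E.
Proof.
move=> H; elim: n => [|n IH].
  rewrite (_ : (fun _ => _) = cst 0); last by apply/funext => y; rewrite big_ord0.
  rewrite (_ : (fun _ => _)%E = cst 0%:E); last by apply/funext => y; rewrite big_ord0.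
  by apply: upper_gradient_cst => // y z; rewrite subrr normr0 mul0r.
have := upper_gradientD _ _ _ _ IH (H n).
by congr upper_gradient; apply/funext => y; rewrite big_ord_recr.
Qed.

Lemma upper_gradient_weak p f g : p != 0 -> upper_gradient d f g ->
  pweak_upper_gradient d mu p f g.
Proof.
move=> p0 [b g0 u]; split => //.
rewrite (_ : [set c | _] = set0); last first.
  by apply/seteqP; split => // c /= [cc]; apply; exact: u.
apply/eqP; rewrite eq_le; apply/andP; split.
  apply: ereal_inf_lbound; exists (cst 0%E) => /=.
    by split => //; apply/d_borelP; exact: measurable_cst.
  by apply: integral0_eq => y _ /=; rewrite powR0.
apply: le_ereal_inf_tmp => _ [rho _ <-].
by apply: integral_ge0 => y _; exact: poweR_ge0.
Qed.

(** * Tent functions and their dyadic averages *)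

Variable x : X.
Let B := dball d x.
Let m r := fine (mu (B r)).

Definition tent (rho : R) (y : X) : R :=
  Num.max 0 (Num.min 1 (2 - d x y / rho)).

Lemma tent_ge0 rho y : 0 <= tent rho y.
Proof. by rewrite /tent le_max lexx. Qed.

Lemma tent_le1 rho y : tent rho y <= 1.
Proof. by rewrite /tent ge_max ler01 ge_min lexx. Qed.

Lemma tent_eq1 rho y : 0 < rho -> B rho y -> tent rho y = 1.
Proof.
move=> r0 Bry; rewrite /tent min_l ?max_r//.
by rewrite lerBrDl -lerBrDr (_ : 2 - 1 = 1 :> R) ?ler_pdivrMr ?mul1r ?ltW//; ring.
Qed.

Lemma tent_eq0 rho y : 0 < rho -> ~ B (2 * rho) y -> tent rho y = 0.
Proof.
move=> r0 /negP; rewrite -leNgt => Bry; rewrite /tent max_l//.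
by rewrite ge_min subr_le0 ler_pdivlMr// Bry orbT.
Qed.

Lemma tent_lip rho y z : 0 < rho -> `|tent rho y - tent rho z| <= rho^-1 * d y z.
Proof.
move=> r0; rewrite /tent.
case: dm => _ _ ds dt.
have h : `|d x y / rho - d x z / rho| <= rho^-1 * d y z.
  rewrite -mulrBl normrM [leRHS]mulrC (@gtr0_norm _ rho^-1) ?invr_gt0//.
  apply: ler_wpM2r; first by rewrite invr_ge0 ltW.
  by rewrite ler_norml; have := dt x y z; have := dt x z y; rewrite (ds z y); lra.
apply: le_trans h.
move: (d x y / rho) (d x z / rho) => a b.
rewrite ler_norml; have := ler_norm (a - b); have := ler_norm (b - a).
rewrite distrC; move: `|a - b| => c h1 h2.
by rewrite /Num.max /Num.min; repeat case: ifPn; rewrite -?leNgt => *; lra.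
Qed.

Lemma measurable_dist : measurable_fun setT (d x).
Proof.
apply: (measurability (@RGenInftyO.G R)).
  exact: RGenInftyO.measurableE.
move=> _ [_ [a ->] <-]; rewrite setTI.
rewrite (_ : _ @^-1` _ = B a); last by apply/seteqP; split => y /=; rewrite in_itv.
exact: dball_measurable.
Qed.

Lemma measurable_tent rho : measurable_fun setT (tent rho).
Proof.
apply: measurable_maxr => //; apply: measurable_minr => //.
by apply: measurable_funB => //; apply: measurable_funM => //; exact: measurable_dist.
Qed.

(** The Lipschitz constant, cut off outside the support. The gradient lives on a whole ball and not
    on an annulus, so dyadic gradients overlap; [sum_dyadic_le] controls the overlap. *)
Lemma upper_gradient_tent rho : 0 < rho ->
  upper_gradient d (tent rho) (fun y => (rho^-1 * \1_(B (2 * rho)) y)%:E).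
Proof.
move=> r0.
have := upper_gradient_cutoff d dm (tent rho) (cst rho^-1%:E) (B (2 * rho)).
rewrite (_ : _ \_ _ = (fun y => (rho^-1 * \1_(B (2 * rho)) y)%:E)); last first.
  apply/funext => y; rewrite /patch indicE.
  by case: ifPn => _; rewrite ?mulr1 ?mulr0.
apply.
- exact: dball_open.
- exact: tent_ge0.
- by move=> y; exact: tent_eq0.
- apply: upper_gradient_cst; first by rewrite invr_ge0 ltW.
  by move=> y z; exact: tent_lip.
Qed.

(** A geometric series; the induction removes the smallest scale and doubles [r]. *)
Lemma sum_dyadic_le K r y : 0 < r ->
  \sum_(j < K) (2 ^+ j * r)^-1 * \1_(B (2 * (2 ^+ j * r))) y <= 2 / r.
Proof.
elim: K r => [|K IH] r r0; first by rewrite big_ord0 divr_ge0 ?ltW.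
rewrite big_ord_recl expr0 mul1r.
under eq_bigr do rewrite lift0 exprSr -mulrA.
have := IH (2 * r); rewrite mulr_gt0// => /(_ isT).
rewrite (_ : 2 / (2 * r) = r^-1); last by field; rewrite gt_eqF.
move=> /(lerD _) h; apply: le_trans (h _ _ _) _.
  by rewrite indicE; apply: (_ : _ <= r^-1); case: (_ \in _); rewrite ?mulr1// mulr0 invr_ge0 ltW.
lra.
Qed.

(** The smallest ball that contains [y] dominates the geometric sum, so its single term on the right
    suffices. Convexity of the power would lose a factor K^(p-1), which is the whole gain of the
    averaging. *)
Lemma pow_sum_dyadic_le p K r y : 0 < p -> 0 < r ->
  (\sum_(j < K) (2 ^+ j * r)^-1 * \1_(B (2 * (2 ^+ j * r))) y) `^ p <=
  \sum_(j < K) (2 / (2 ^+ j * r)) `^ p * \1_(B (2 * (2 ^+ j * r))) y.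
Proof.
move=> p0; elim: K r => [|K IH] r r0; first by rewrite !big_ord0 powR0 ?gt_eqF.
have [yB|yB] := boolP (y \in B (2 * r)); last first.
  rewrite !big_ord_recl expr0 mul1r indicE (negbTE yB) !mulr0 !add0r.
  under eq_bigr do rewrite lift0 exprSr -mulrA.
  under [leRHS]eq_bigr do rewrite lift0 exprSr -mulrA.
  by apply: IH; rewrite mulr_gt0.
rewrite [leRHS]big_ord_recl expr0 mul1r indicE yB mulr1.
apply: (@le_trans _ _ ((2 / r) `^ p)).
  apply: ge0_ler_powR; rewrite ?nnegrE; [exact: ltW| |by rewrite divr_ge0 ?ltW|].
    by apply: sumr_ge0 => j _; rewrite mulr_ge0// invr_ge0 mulr_ge0 ?exprn_ge0 ?ltW.
  exact: sum_dyadic_le.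
by rewrite lerDl sumr_ge0// => j _; rewrite mulr_ge0 ?powR_ge0.
Qed.


Hypothesis mball : forall (y : X) (r : R), 0 < r ->
  (0 < mu (dball d y r) < +oo)%E.

Lemma mu_dballE r : 0 < r -> mu (B r) = (m r)%:E.
Proof.
by move=> /(mball x)/andP[h1 h2]; rewrite fineK// ge0_fin_numE// ltW.
Qed.

(** The average of [K] tents has a gradient with factor 1/K; its energy is K^(-p) times [K] terms of
    size at most [M], up to the 2^p of the geometric sum. The case [K = 1] is a single tent. *)
Lemma capacity_le_dyadic p K r M (E Om : set X) : 1 < p -> (0 < K)%N -> 0 < r ->
  E `<=` B r -> measurable Om -> B (2 ^+ K * r) `<=` Om ->
  (forall j, (j < K)%N -> m (2 * (2 ^+ j * r)) / (2 ^+ j * r) `^ p <= M) ->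
  (capacity d mu p E Om <= (2 `^ p * K%:R `^ (1 - p) * M)%:E)%E.
Proof.
move=> p1 K0 r0 EB mOm BOm HM.
have p0 : 0 < p by apply: lt_trans p1.
pose rho j : R := 2 ^+ j * r.
have rho0 j : 0 < rho j by rewrite mulr_gt0// exprn_gt0.
have k0 : 0 < K%:R :> R by rewrite ltr0n.
pose u y := K%:R^-1 * \sum_(j < K) tent (rho j) y.
pose w y := \sum_(j < K) (rho j)^-1 * \1_(B (2 * rho j)) y.
pose G y := (K%:R^-1 * w y)%:E.
have w0 y : 0 <= w y.
  by apply: sumr_ge0 => j _; rewrite mulr_ge0// invr_ge0 ltW.
have uG : upper_gradient d u G.
  have H := upper_gradient_sum (fun j => tent (rho j)) _ K
    (fun j => upper_gradient_tent (rho j) (rho0 j)).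
  have k0' : 0 <= K%:R^-1 :> R by rewrite invr_ge0 ltW.
  have := upper_gradientZ _ _ _ k0' H.
  by congr upper_gradient; apply/funext => y; rewrite /G EFinM sumEFin.
pose c j := (2 / K%:R / rho j) `^ p.
have GE y : (G y `^ p <= \sum_(j < K) (c j)%:E * (\1_(B (2 * rho j)) y)%:E)%E.
  rewrite /G poweR_EFin; under eq_bigr do rewrite -EFinM.
  rewrite sumEFin lee_fin powRM// ?invr_ge0 ?(ltW k0)//.
  have := pow_sum_dyadic_le p K r y p0 r0; rewrite -/(w y).
  move=> /(ler_wpM2l (powR_ge0 K%:R^-1 p)) /le_trans; apply.
  rewrite mulr_sumr; apply: ler_sum => j _; rewrite -/(rho j) /c.
  rewrite (_ : 2 / K%:R / rho j = K%:R^-1 * (2 / rho j)); last by ring.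
  by rewrite [in leRHS]powRM ?mulrA// ?divr_ge0// ?invr_ge0 ltW.
have mB2 j : measurable (B (2 * rho j)) by exact: dball_measurable.
have intG : (\int[mu]_y (G y `^ p) <= (2 `^ p * K%:R `^ (1 - p) * M)%:E)%E.
  apply: (@le_trans _ _ (\int[mu]_y
      (\sum_(j < K) (c j)%:E * (\1_(B (2 * rho j)) y)%:E))%E).
    apply: ge0_le_integral => //.
    - by move=> y _; exact: poweR_ge0.
    - have [bG _ _] := uG.
      exact: measurableT_comp (measurable_poweR _) (borel_measurable_fun _ bG).
    - apply: emeasurable_sum => j; apply: measurable_funeM.
      by apply/measurable_EFinP; exact: measurable_indic.
  rewrite ge0_integral_sum//; last 2 first.
  - move=> j; apply: measurable_funeM.
    by apply/measurable_EFinP; exact: measurable_indic.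
  - by move=> j y _; apply: mule_ge0; rewrite lee_fin ?powR_ge0.
  have -> : (2 `^ p * K%:R `^ (1 - p) * M) = \sum_(j < K) (2 / K%:R) `^ p * M.
    rewrite sumr_const card_ord -[RHS]mulr_natl.
    have Kp : 0 <= K%:R^-1 :> R by rewrite invr_ge0 ltW.
    rewrite (powRM _ (ler0n R 2) Kp).
    rewrite powRD; last by rewrite (gt_eqF k0) implybT.
    rewrite powRr1 ?(ltW k0)// -[in RHS]powR_inv1 ?(ltW k0)// -powRrM mulN1r; ring.
  rewrite -sumEFin; apply: lee_sum => j _.
  rewrite ge0_integralZl_EFin//; last 2 first.
  - by apply/measurable_EFinP; exact: measurable_indic.
  - exact: powR_ge0.
  rewrite integral_indic// setIT mu_dballE ?mulr_gt0// -EFinM lee_fin.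
  rewrite /c powRM ?divr_ge0 ?invr_ge0 ?(ltW k0) ?(ltW (rho0 j))//.
  rewrite -mulrA ler_wpM2l ?powR_ge0//.
  apply: le_trans (HM j _) => //.
  by rewrite mulrC -powR_inv1 ?(ltW (rho0 j))// -powRrM mulN1r powRN.
have K1 : K%:R^-1 * (\sum_(j < K) 1) = 1 :> R.
  by rewrite sumr_const card_ord mulVf// gt_eqF.
have rhoE : rho 0%N = r by rewrite /rho expr0 mul1r.
have rhole i j : (i <= j)%N -> rho i <= rho j.
  by move=> ij; rewrite /rho ler_pM2r// ler_eXn2l// ltr1n.
have u01 y : 0 <= u y <= 1.
  rewrite /u mulr_ge0 ?invr_ge0 ?(ltW k0) ?sumr_ge0//=; last first.
    by move=> j _; exact: tent_ge0.
  rewrite -[leRHS]K1 ler_pM2l ?invr_gt0//.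
  by apply: ler_sum => j _; exact: tent_le1.
have u0 y : ~ B (2 ^+ K * r) y -> u y = 0.
  move=> Hy; rewrite /u big1 ?mulr0// => j _; apply: tent_eq0 => // h.
  apply: Hy; apply: lt_le_trans h _.
  rewrite (_ : 2 * rho j = rho j.+1) ?rhole//.
  by rewrite /rho exprS mulrA.
have meas_u : measurable_fun setT u.
  apply: measurable_funM => //.
  by apply: measurable_sum => j; exact: measurable_tent.
have mbig : measurable (B (2 ^+ K * r)) by exact: dball_measurable.
apply: le_trans (intG).
apply: (@le_trans _ _ (\int[mu]_(y in Om) (G y `^ p))%E); last first.
  apply: ge0_subset_integral => //.
  - have [bG _ _] := uG.
    exact: measurableT_comp (measurable_poweR _) (borel_measurable_fun _ bG).
  - by move=> y _; exact: poweR_ge0.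
apply: ereal_inf_lbound; exists (u, G) => //; split => /=.
- split => //.
  + apply: (@le_lt_trans _ _ (\int[mu]_y (\1_(B (2 ^+ K * r)) y)%:E)%E).
      apply: ge0_le_integral => //.
      * by move=> y _; exact: poweR_ge0.
      * apply: (measurableT_comp (measurable_poweR _)).
        by apply/measurable_EFinP; exact: measurableT_comp.
      * by apply/measurable_EFinP; exact: measurable_indic.
      * move=> y _; rewrite poweR_EFin lee_fin indicE.
        case/andP: (u01 y) => h1 h2; case: (boolP (_ \in _)) => yB.
          rewrite ger0_norm// (_ : 1%:R = 1 `^ p :> R); last by rewrite powR1.
          by apply: ge0_ler_powR; rewrite ?nnegrE// ltW.
        rewrite u0 ?normr0 ?powR0 ?gt_eqF//.
        by move=> h; move: yB; rewrite mem_set.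
    rewrite integral_indic// setIT mu_dballE ?ltry// mulr_gt0// exprn_gt0//.
  + by exists G; split => //; apply: le_lt_trans intG _; rewrite ltry.
- by move=> y Hy; apply: u0 => /BOm.
- move=> y /EB By; rewrite /u -[leLHS]K1 ler_pM2l ?invr_gt0//.
  apply: ler_sum => j _; rewrite tent_eq1//.
  by apply: lt_le_trans By _; rewrite -rhoE rhole.
- by apply: upper_gradient_weak => //; rewrite gt_eqF.
Qed.

Lemma capacity_le_log p r R' M : 1 < p -> 0 < r -> 2 * r <= R' ->
  (forall rho, r <= rho -> 2 * rho <= R' -> m (2 * rho) / rho `^ p <= M) ->
  (capacity d mu p (B r) (B R') <= (2 `^ p * 2 `^ p * M * ln (R' / r) `^ (1 - p))%:E)%E.
Proof.
move=> p1 r0 rR HM.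
have R0 : 0 < R' by apply: lt_le_trans rR; rewrite mulr_gt0.
have ex : exists n, R' < 2 ^+ n * r.
  exists (Num.truncn (R' / r)).+1.
  rewrite -ltr_pdivrMr//; apply: lt_le_trans (truncnS_gt _) _.
  by rewrite -natrX ler_nat ltnW// ltn_expl.
(* [K.+2] is the first exponent with [R' < 2 ^+ K.+2 * r], so [K.+1] scales fit into [B R'];
   exponents 0 and 1 contradict [2 * r <= R']. *)
have [[|[|K]] HK Kmin] := ex_minnP ex.
- by move: HK; rewrite expr0 mul1r ltNge (le_trans _ rR)// ler_peMl ?ltW// ltr1n.
- by move: HK; rewrite expr1 ltNge rR.
have KR : 2 ^+ K.+1 * r <= R'.
  by rewrite leNgt; apply/negP => /Kmin; rewrite ltnn.
have M0 : 0 <= M.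
  apply: le_trans (HM r _ _) => //.
  by rewrite divr_ge0 ?powR_ge0// fine_ge0.
apply: (le_trans (capacity_le_dyadic p K.+1 r M _ _ p1 isT r0 _ _ _ _)).
- by [].
- exact: dball_measurable.
- by move=> y /lt_le_trans; apply.
- move=> j jK; apply: HM.
    by apply: ler_peMl; [exact: ltW|apply: exprn_ege1; rewrite ler1n].
  by apply: le_trans KR; rewrite mulrA -exprS ler_pM2r// ler_eXn2l// ltr1n.
rewrite lee_fin -!mulrA ler_wpM2l ?powR_ge0// [leRHS]mulrCA [leLHS]mulrC.
rewrite ler_wpM2l//.
have lnE : ln (R' / r) <= 2 * K.+1%:R.
  have : ln (R' / r) <= ln (2 ^+ K.+2).
    by rewrite ler_ln ?posrE ?divr_gt0 ?exprn_gt0// ler_pdivrMr// ltW.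
  move=> /le_trans; apply; rewrite lnXn// -[leLHS]mulr_natl.
  have : ln 2 <= 1 :> R.
    by rewrite -[leRHS](@expRK R 1) ler_ln ?posrE ?expR_gt0//; have := @expR_ge1Dx R 1; lra.
  move=> h; apply: (@le_trans _ _ K.+2%:R); first by rewrite ler_piMr.
  rewrite -natrM ler_nat; move: K {HK Kmin KR} => K; lia.
have ln0 : 0 < ln (R' / r).
  by rewrite ln_gt0// ltr_pdivlMr// mul1r; apply: lt_le_trans rR; lra.
(* The logarithm is compared with [2 * K.+1]; as 1 - p is negative this costs 2^(p-1), which the
   second factor 2^p of the statement covers. *)
have -> : K.+1%:R `^ (1 - p) = 2 `^ (p - 1) * (2 * K.+1%:R) `^ (1 - p) :> R.
  rewrite powRM// mulrA -powRD; last by rewrite pnatr_eq0 implybT.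
  by rewrite (_ : p - 1 + (1 - p) = 0) ?powRr0 ?mul1r//; ring.
apply: ler_pM; rewrite ?powR_ge0//.
  by apply: ler_powR; [rewrite ler1n|lra].
rewrite -(opprB p 1) !powRN lef_pV2 ?posrE ?powR_gt0// ?mulr_gt0//.
apply: ge0_ler_powR; rewrite ?nnegrE ?mulr_ge0 ?(ltW ln0) ?subr_ge0//; exact: ltW.
Qed.

End UpperBound.

(** * Connectivity and growth of balls *)

(** Apply [ln s < s] to s = t^(b/a) and raise the result to the power [a]. *)
Lemma ln_powR_le {R : realType} (a b : R) : 0 < a -> 0 < b ->
  exists C : R, 0 < C /\ forall t, 1 <= t -> ln t `^ a <= C * t `^ b.
Proof.
move=> a0 b0; pose e := b / a; have e0 : 0 < e by rewrite divr_gt0.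
exists (e^-1 `^ a); split; first by rewrite powR_gt0 ?invr_gt0.
move=> t t1; have t0 : 0 < t by apply: lt_le_trans t1.
have -> : t `^ b = (t `^ e) `^ a by rewrite -powRrM /e divfK ?gt_eqF.
rewrite -powRM ?powR_ge0 ?invr_ge0 ?(ltW e0)//.
apply: ge0_ler_powR; rewrite ?nnegrE ?ln_ge0 ?mulr_ge0 ?powR_ge0 ?invr_ge0 ?(ltW e0) ?(ltW a0)//.
rewrite mulrC ler_pdivlMr// mulrC -ln_powR.
by apply/ltW/ln_sublinear; rewrite powR_gt0.
Qed.

Section Growth.
Context {R : realType} {dsp : measure_display} {X : measurableType dsp}.
Variables (d : X -> X -> R) (mu : {measure set X -> \bar R}).
Hypothesis dm : is_metric d.
Hypothesis mopen : forall U : set X, d_open d U -> measurable U.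
Hypothesis mball : forall (y : X) (r : R), 0 < r ->
  (0 < mu (dball d y r) < +oo)%E.

Let m y r := fine (mu (dball d y r)).

Let mE y r : 0 < r -> mu (dball d y r) = (m y r)%:E.
Proof. by move=> r0; apply: mu_dballE. Qed.

Lemma mball_gt0 y r : 0 < r -> 0 < fine (mu (dball d y r)).
Proof. by move=> r0; rewrite -lte_fin -[ltRHS]mE//; case/andP: (mball y r r0). Qed.

Lemma mball_sub y z r s : 0 < r -> 0 < s -> dball d y r `<=` dball d z s ->
  fine (mu (dball d y r)) <= fine (mu (dball d z s)).
Proof.
move=> r0 s0 sub; rewrite -lee_fin -[leLHS]mE// -[leRHS]mE//.
by apply: le_measure => //; rewrite inE; exact: dball_measurable.
Qed.

Lemma mball_le y r s : 0 < r -> r <= s ->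
  fine (mu (dball d y r)) <= fine (mu (dball d y s)).
Proof.
move=> r0 rs; apply: mball_sub => //; first exact: lt_le_trans rs.
by move=> z /lt_le_trans; apply.
Qed.

(** If no point had its distance to [x] in [s, t), no curve could cross the gap, and the indicator
    of the ball of radius [s] would have upper gradient zero. The Poincare inequality would make it
    constant on a ball, although it is 1 near [x] and 0 near [z]. *)
Lemma annulus_nonempty p0 x z s t : 1 <= p0 -> global_poincare d mu p0 ->
  0 < s -> s < t -> t <= d x z -> exists y, s <= d x y < t.
Proof.
move=> p1 [C [lam [C1 l1 H]]] s0 st tz; apply: contrapT => nex.
case: dm => d0 _ ds dt.
have p0gt : 0 < p0 by apply: lt_le_trans p1.
have gap y : s <= d x y -> t <= d x y.
  by move=> sy; rewrite leNgt; apply/negP => yt; apply: nex; exists y; rewrite sy.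
pose f : X -> R := \1_(dball d x s).
have mB y r : measurable (dball d y r) by exact: dball_measurable.
have intf : mu.-integrable setT (EFin \o f).
  apply/integrableP; split; first by apply/measurable_EFinP; exact: measurable_indic.
  under eq_integral do rewrite /= ger0_norm//.
  by rewrite integral_indic// setIT mE// ltry.
have ugf : upper_gradient d f (cst 0%E).
  split => //; first by apply/d_borelP; exact: measurable_cst.
  move=> c cc; rewrite /ug_ineq line_intE integral0.
  suff -> : f (c.1 0) = f (c.1 c.2) by rewrite subrr normr0.
  have l0 : 0 < c.2 by case: cc.
  (* Freezing the parameter outside [[0, c.2]] makes the distance to [x] along the curve continuous
     on the line, so that the intermediate value theorem applies. *)
  pose clamp (r : R) := Num.min c.2 (Num.max 0 r).
  have cl r : 0 <= clamp r <= c.2.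
    by rewrite /clamp le_min ge_min lexx (ltW l0) le_max lexx.
  pose phi r := d x (c.1 (clamp r)).
  have phi_lip a b : `|phi a - phi b| <= `|a - b|.
    wlog ab : a b / a <= b.
      move=> W; have [/W//|/ltW/W] := leP a b.
      by rewrite distrC (distrC b).
    have cab : clamp a <= clamp b /\ clamp b - clamp a <= b - a.
      by rewrite /clamp /Num.min /Num.max; repeat case: ifPn; rewrite -?leNgt => *; lra.
    have [/andP[ca0 _] /andP[_ cb0]] := (cl a, cl b).
    have hc := curve_lip _ _ _ _ cc ca0 cab.1 cb0.
    rewrite /phi distrC (distrC a) [leRHS]ger0_norm ?subr_ge0//.
    have := dt x (c.1 (clamp a)) (c.1 (clamp b)).
    have := dt x (c.1 (clamp b)) (c.1 (clamp a)).
    rewrite (ds (c.1 (clamp b)) (c.1 (clamp a))) ler_norml; case: cab; lra.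
  have phic : continuous phi.
    move=> a; apply/cvgrPdist_lt => e e0.
    apply/nbhs_ballP; exists e => // b; rewrite /ball/= => ab.
    exact: le_lt_trans (phi_lip _ _) ab.
  have c0 : clamp 0 = 0 by rewrite /clamp max_l// min_r// ltW.
  have c2 : clamp c.2 = c.2 by rewrite /clamp max_r ?min_l// ltW.
  have Hiv : ~ (Num.min (phi 0) (phi c.2) <= s <= Num.max (phi 0) (phi c.2)).
    move=> /(IVT (ltW l0) (continuous_subspaceT phic)) [r _ rs].
    by have := gap (c.1 (clamp r)); rewrite -/(phi r) rs lexx => /(_ isT); rewrite leNgt st.
  rewrite /f !indicE; congr (_%:R).
  have inE' y : (y \in dball d x s) = (d x y < s).
    by apply/idP/idP; rewrite inE.
  rewrite !inE' -{1}c0 -{1}c2 -/(phi 0) -/(phi c.2).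
  case: (ltP (phi 0) s) => h1; case: (ltP (phi c.2) s) => h2 //; exfalso; apply: Hiv.
    by rewrite ge_min le_max (ltW h1) h2 orbT.
  by rewrite ge_min le_max (ltW h2) h1 !orbT.
(* Large enough for this ball to contain the balls of radius [s] about [x] and [t - s] about [z]. *)
pose r := d x z + t.
have r0 : 0 < r by rewrite ltr_wpDl// (lt_trans s0).
have := H x r f (cst 0%E) r0 intf ugf; cbv zeta; set fB := (_ / _).
rewrite [X in (_ <= _ * (_ * X) `^ _)%E](_ : _ = 0%E); last first.
  by apply: integral0_eq => y _ /=; rewrite powR0// gt_eqF.
rewrite mule0 poweR0r ?invr_eq0 ?gt_eqF// mule0 => Hle.
have mf : measurable_fun setT (fun y => (`|f y - fB|)%:E).
  apply/measurable_EFinP; apply: measurableT_comp => //.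
  by apply: measurable_funB => //; exact: measurable_indic.
(* A value taken on a whole ball, hence on a set of positive measure, must equal the mean [fB]. *)
have key (v : R) y e : 0 < e -> dball d y e `<=` dball d x r ->
    (forall w, dball d y e w -> f w = v) -> v = fB.
  move=> e0 sub fv; apply/eqP; rewrite -subr_eq0 -normr_le0.
  have : (\int[mu]_(w in dball d y e) (`|f w - fB|)%:E <= 0)%E.
    apply: le_trans Hle; apply: ge0_subset_integral => //.
    exact: measurable_funTS.
  rewrite (eq_integral (cst `|v - fB|%:E)); last first.
    by move=> w; rewrite inE => /fv ->.
  rewrite integral_cst// mE// -EFinM lee_fin pmulr_lle0//; exact: mball_gt0.
have h1 : 1 = fB.
  apply: (key 1 x s) => //.
    by move=> w /lt_trans; apply; rewrite (lt_le_trans st)// lerDr.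
  by move=> w ws; rewrite /f indicE mem_set.
have : 0 = fB; last by rewrite -h1 => /eqP; rewrite eq_sym oner_eq0.
apply: (key 0 z (t - s)); first by rewrite subr_gt0.
  move=> w; rewrite /dball/= => zw; apply: le_lt_trans (dt _ z _) _.
  rewrite ltrD2l; apply: lt_le_trans zw _; rewrite gerBl; exact: ltW.
move=> w; rewrite /dball/= => zw; rewrite /f indicE memNset// /dball/=.
by apply/negP; rewrite -leNgt; have := dt x w z; rewrite (ds w z); lra.
Qed.

Variables (x z : X) (R0 p0 D : R).
Hypotheses (R0_gt0 : 0 < R0) (p01 : 1 <= p0) (poin : global_poincare d mu p0).
Hypothesis far : 2 * R0 < d x z.
Hypothesis D1 : 1 <= D.
Hypothesis doub : forall y (r : R), 0 < r ->
    (mu (dball d y (2 * r)) <= D%:E * mu (dball d y r))%E.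

Lemma doubling_iter y r n : 0 < r -> m y (2 ^+ n * r) <= D ^+ n * m y r.
Proof.
move=> r0; elim: n => [|n IH]; first by rewrite !expr0 !mul1r.
have h : 0 < 2 ^+ n * r by rewrite mulr_gt0// exprn_gt0.
have := doub y _ h; rewrite !mE ?mulr_gt0// ?exprn_gt0// -EFinM lee_fin.
rewrite mulrA -exprS => /le_trans; apply.
by rewrite exprS -mulrA ler_wpM2l// (le_trans ler01).
Qed.

(** A point [y] with d(x, y) between 3 rho/2 and 2 rho gives a ball of radius rho/2 that is disjoint
    from B(x, rho) and contained in B(x, 4 rho). Four doublings of it cover B(x, 4 rho), hence the
    constant. *)
Lemma reverse_doubling rho : 0 < rho -> rho <= R0 ->
  m x rho <= (1 - (D ^+ 4)^-1) * m x (4 * rho).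
Proof.
move=> r0 rR; case: dm => d0 _ ds dt.
have [y /andP[y1 y2]] : exists y, (3 / 2) * rho <= d x y < 2 * rho.
  apply: (annulus_nonempty _ _ z _ _ p01 poin); [lra|lra|].
  by apply: le_trans (ltW far); rewrite ler_pM2l.
have D4 : 0 < D ^+ 4 by rewrite exprn_gt0// (lt_le_trans ltr01).
have h1 : m x rho + m y (rho / 2) <= m x (4 * rho).
  rewrite -lee_fin EFinD -!mE ?divr_gt0 ?mulr_gt0// -measureU.
  - apply: le_measure; rewrite ?inE.
    + by apply: measurableU; exact: dball_measurable.
    + exact: dball_measurable.
    + move=> w [|]; rewrite /dball/= => h; first lra.
      by have := dt x y w; lra.
  - exact: dball_measurable.
  - exact: dball_measurable.
  - apply/seteqP; split => // w []; rewrite /dball/=.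
    by have := dt x w y; rewrite (ds w y) => *; lra.
have h2 : m x (4 * rho) <= D ^+ 4 * m y (rho / 2).
  apply: le_trans (doubling_iter _ _ _ _); last by rewrite divr_gt0.
  apply: mball_sub; rewrite ?mulr_gt0 ?divr_gt0 ?exprn_gt0//.
  move=> w; rewrite /dball/= (_ : 2 ^+ 4 * (rho / 2) = 8 * rho); last by field.
  by have := dt y x w; rewrite (ds y x) => *; lra.
have : (D ^+ 4)^-1 * m x (4 * rho) <= m y (rho / 2).
  by rewrite [leLHS]mulrC ler_pdivrMr// [leRHS]mulrC.
lra.
Qed.


(** * Exponent sets and changes of the range of radii *)

Variable p : R.
Hypothesis p_gt0 : 0 < p.

(** The exponent sets see radii up to 1 only, the capacity estimates radii up to [M]. Above radius 1
    monotonicity of the measure and the bound M^p on the power suffice. The summand 1 in [1 + C0]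
    admits [r = R']. *)
Lemma Qlow_ext M : 0 < M -> Qlow d mu x p -> exists C, 0 < C /\
  forall r R', 0 < r -> r <= R' -> R' <= M ->
    m x r / r `^ p <= C * (m x R' / R' `^ p).
Proof.
move=> M0 [_ [C0 [C0p H]]].
pose q r := m x r / r `^ p.
have qge0 r : 0 < r -> 0 <= q r.
  by move=> r0; rewrite divr_ge0 ?powR_ge0// ltW// mball_gt0.
have H1 r R' : 0 < r -> r <= R' -> R' <= 1 -> q r <= (1 + C0) * q R'.
  move=> r0 rR R1; have R'0 : 0 < R' by exact: lt_le_trans rR.
  move: rR; rewrite le_eqVlt => /predU1P[<-|rR].
    by rewrite mulrDl mul1r lerDl mulr_ge0 ?qge0// ltW.
  apply: (@le_trans _ _ (C0 * q R')); last first.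
    by rewrite mulrDl mul1r lerDr qge0.
  have := H r R' r0 rR R1; rewrite ler_pdivrMr ?mball_gt0//.
  rewrite /q ler_pdivrMr ?powR_gt0// => /le_trans; apply.
  rewrite powRM ?invr_ge0 ?(ltW r0) ?(ltW R'0)// -powR_inv1 ?(ltW R'0)//.
  rewrite -powRrM mulN1r powRN le_eqVlt; apply/orP; left; apply/eqP; rewrite /m; ring.
have M1 : 1 <= 1 + M `^ p by rewrite lerDl powR_ge0.
exists ((1 + C0) * (1 + M `^ p)); split; first by rewrite mulr_gt0 ?ltr_pwDl ?powR_ge0// ltW.
move=> r R' r0 rR RM; rewrite -/(q r) -/(q R').
have R'0 : 0 < R' by exact: lt_le_trans rR.
have C1 : 1 <= 1 + C0 by rewrite lerDl ltW.
have C1' : 0 <= 1 + C0 by exact: le_trans C1.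
have [R1|R1] := leP R' 1.
  apply: le_trans (H1 _ _ r0 rR R1) _; rewrite -mulrA ler_wpM2l//.
  by rewrite ler_peMl ?qge0.
have mq : m x R' <= (1 + M `^ p) * q R'.
  apply: (@le_trans _ _ (M `^ p * q R')); last by rewrite mulrDl mul1r lerDr qge0.
  rewrite /q mulrA ler_pdivlMr ?powR_gt0// mulrC ler_wpM2r ?(ltW (mball_gt0 _ _ _))//.
  by apply: ge0_ler_powR; rewrite ?nnegrE ?(ltW p_gt0) ?(ltW R'0) ?(ltW M0).
rewrite -mulrA; apply: (@le_trans _ _ ((1 + C0) * m x R')); last by rewrite ler_wpM2l.
have [r1|r1] := leP r 1.
  apply: le_trans (H1 _ 1 r0 r1 (lexx _)) _; rewrite ler_wpM2l//.
  by rewrite /q powR1 divr1 mball_le// ltW.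
apply: (@le_trans _ _ (m x r)).
  rewrite /q ler_pdivrMr ?powR_gt0//; apply: ler_peMr; first by rewrite ltW// mball_gt0.
  by rewrite -(powRr0 r); apply: ler_powR; exact: ltW.
apply: (le_trans (mball_le _ _ _ r0 rR)).
by rewrite ler_peMl// ltW ?mball_gt0.
Qed.

(** Here a large ball is bounded by a small one, so monotonicity is not enough above radius 1; the
    ratio [A] of the measures at radii [M] and 1 enters. *)
Lemma Qup_ext M : 0 < M -> Qup d mu x p -> exists C, 0 < C /\
  forall r R', 0 < r -> r <= R' -> R' <= M ->
    m x R' / R' `^ p <= C * (m x r / r `^ p).
Proof.
move=> M0 [_ [C0 [C0p H]]].
pose q r := m x r / r `^ p.
have qge0 r : 0 < r -> 0 <= q r.
  by move=> r0; rewrite divr_ge0 ?powR_ge0// ltW// mball_gt0.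
have H1 r R' : 0 < r -> r <= R' -> R' <= 1 -> q R' <= (1 + C0^-1) * q r.
  move=> r0 rR R1; have R'0 : 0 < R' by exact: lt_le_trans rR.
  move: rR; rewrite le_eqVlt => /predU1P[<-|rR].
    by rewrite mulrDl mul1r lerDl mulr_ge0 ?qge0// invr_ge0 ltW.
  apply: (@le_trans _ _ (C0^-1 * q r)); last first.
    by rewrite mulrDl mul1r lerDr qge0.
  have := H r R' r0 rR R1; rewrite ler_pdivlMr ?mball_gt0//.
  rewrite [X in _ -> _ <= X]mulrC ler_pdivlMr// /q ler_pdivlMr ?powR_gt0//.
  apply: le_trans.
  rewrite powRM ?invr_ge0 ?(ltW r0) ?(ltW R'0)// -[in leRHS]powR_inv1 ?(ltW R'0)//.
  rewrite -powRrM mulN1r powRN le_eqVlt; apply/orP; left; apply/eqP; rewrite /m; ring.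
have C1 : 1 <= 1 + C0^-1 by rewrite lerDl invr_ge0 ltW.
have C1' : 0 <= 1 + C0^-1 by exact: le_trans C1.
have m1 : 0 < m x 1 by exact: mball_gt0.
pose A := (m x M / m x 1).
have A0 : 0 < A by rewrite divr_gt0 ?mball_gt0.
pose K := 1 + A * (1 + M `^ p).
have K1 : 1 <= K by rewrite lerDl mulr_ge0 ?addr_ge0 ?powR_ge0// ltW.
exists ((1 + C0^-1) * K); split.
  by rewrite mulr_gt0//; [apply: lt_le_trans C1|apply: lt_le_trans K1].
move=> r R' r0 rR RM; rewrite -/(q r) -/(q R').
have R'0 : 0 < R' by exact: lt_le_trans rR.
have [R1|R1] := leP R' 1.
  apply: le_trans (H1 _ _ r0 rR R1) _; rewrite -mulrA ler_wpM2l//.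
  by rewrite ler_peMl ?qge0.
have qR : q R' <= A * m x 1.
  rewrite /A divfK ?gt_eqF//; apply: (@le_trans _ _ (m x R')); last exact: mball_le.
  rewrite /q ler_pdivrMr ?powR_gt0//; apply: ler_peMr; first by rewrite ltW// mball_gt0.
  by rewrite -(powRr0 R'); apply: ler_powR; exact: ltW.
apply: (le_trans qR).
have [r1|r1] := leP r 1.
  have := H1 _ 1 r0 r1 (lexx _); rewrite {1}/q powR1 divr1 => h.
  rewrite [leRHS]mulrAC [leRHS]mulrC; apply: ler_pM; [exact: ltW|exact: ltW| |exact: h].
  by rewrite /K; have := mulr_ge0 (ltW A0) (powR_ge0 M p); lra.
apply: (@le_trans _ _ (A * (1 + M `^ p) * q r)).
  rewrite -(mulrA A); apply: ler_wpM2l; first exact: ltW.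
  rewrite /q mulrA ler_pdivlMr ?powR_gt0// mulrC.
  apply: ler_pM; rewrite ?powR_ge0 ?(ltW m1)//.
    apply: (@le_trans _ _ (M `^ p)); last by rewrite lerDr.
    by apply: ge0_ler_powR; rewrite ?nnegrE ?(ltW r0) ?(ltW M0) ?(ltW p_gt0)// (le_trans rR).
  by apply: mball_le => //; exact: ltW.
apply: ler_wpM2r; first exact: qge0.
apply: (@le_trans _ _ K); first by rewrite /K lerDr.
by rewrite ler_peMl// (le_trans ler01).
Qed.

Lemma Qlow_of_annuli C : 0 < C ->
  (forall r R', 0 < r -> 2 * r <= R' -> R' <= R0 ->
    m x r / m x R' <= C * (r / R') `^ p) -> Qlow d mu x p.
Proof.
move=> C0 H; split => //.
(* Chosen so that [2 * R' <= T * Num.min R' R0] whenever [R' <= 1]. If [2 * r] exceeds this minimum,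
   then [T * (r / R')] is at least 1 and the bound is trivial. *)
pose T := 2 * (1 + R0^-1).
have T0 : 0 < T by rewrite mulr_gt0// addr_gt0// invr_gt0.
exists ((C + 1) * T `^ p); split; first by rewrite mulr_gt0 ?addr_gt0 ?powR_gt0.
move=> r R' r0 rR R1; have R'0 : 0 < R' by exact: lt_trans rR.
pose S := Num.min R' R0.
have S0 : 0 < S by rewrite lt_min R'0.
have SR : S <= R' by rewrite ge_min lexx.
have SR0 : S <= R0 by rewrite ge_min lexx orbT.
have RS : 2 * R' <= T * S.
  rewrite /T -mulrA ler_pM2l// /S; case: (leP R' R0) => h.
    by rewrite mulrDl mul1r lerDl mulr_ge0 ?invr_ge0 ?(ltW R0_gt0) ?(ltW R'0).
  by rewrite mulrDl mul1r mulVf ?gt_eqF// (le_trans R1)// lerDr ltW.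
rewrite -mulrA -powRM ?divr_ge0 ?(ltW T0) ?(ltW r0) ?(ltW R'0)//.
have [h|h] := leP (2 * r) S.
  apply: (@le_trans _ _ (m x r / m x S)).
    rewrite ler_pM2l ?mball_gt0// lef_pV2 ?posrE ?mball_gt0//; exact: mball_le.
  apply: le_trans (H _ _ r0 h SR0) _.
  apply: ler_pM; rewrite ?powR_ge0 ?(ltW C0)//; first by rewrite lerDl.
  apply: ge0_ler_powR; rewrite ?nnegrE.
  - exact: ltW.
  - by rewrite divr_ge0 ?(ltW r0) ?(ltW S0).
  - by rewrite mulr_ge0 ?divr_ge0 ?(ltW r0) ?(ltW R'0) ?(ltW T0).
  rewrite mulrCA ler_pM2l// ler_pdivlMr// mulrC ler_pdivrMr//.
  by apply: le_trans RS; lra.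
apply: (@le_trans _ _ 1).
  by rewrite ler_pdivrMr ?mball_gt0// mul1r; apply: mball_le => //; exact: ltW.
rewrite -[leLHS]mulr1; apply: ler_pM => //; first by rewrite lerDr ltW.
rewrite -(powRr0 (T * (r / R'))); apply: ler_powR; last exact: ltW.
rewrite mulrA ler_pdivlMr// mul1r.
have : T * S <= T * (2 * r) by rewrite ler_pM2l// ltW.
lra.
Qed.

Lemma Qup_of_annuli C : 0 < C ->
  (forall r R', 0 < r -> 2 * r <= R' -> R' <= R0 ->
    C * (r / R') `^ p <= m x r / m x R') -> Qup d mu x p.
Proof.
move=> C0 H; split => //.
have D0 : 0 < D by exact: lt_le_trans D1.
pose k1 := m x R0 / m x 1; pose k2 := m x (R0 / 2) / m x 1.
have k10 : 0 < k1 by rewrite divr_gt0 ?mball_gt0.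
have k20 : 0 < k2 by rewrite divr_gt0 ?mball_gt0 ?divr_gt0.
(* One constant per case: [C] for [2 * r <= R' <= R0], [D^-1] for [R' <= R0] and [R' < 2 * r],
   [C * k1] for [2 * r <= R0 < R'], and [k2] when both [R'] and [2 * r] exceed [R0]. *)
exists (Num.min (Num.min C (C * k1)) (Num.min D^-1 k2)); split.
  by rewrite !lt_min C0 k20 invr_gt0 D0 mulr_gt0.
move=> r R' r0 rR R1; have R'0 : 0 < R' by exact: lt_trans rR.
set K := Num.min _ _.
have q0 : 0 <= (r / R') `^ p by exact: powR_ge0.
have q1 : (r / R') `^ p <= 1.
  rewrite (_ : 1 = 1 `^ p :> R); last by rewrite powR1.
  apply: ge0_ler_powR; rewrite ?nnegrE ?(ltW p_gt0)//.
    by rewrite divr_ge0 ?ltW.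
  by rewrite ler_pdivrMr// mul1r ltW.
have K0 : 0 <= K by apply: ltW; rewrite /K !lt_min C0 k20 invr_gt0 D0 mulr_gt0.
have [RR|RR] := leP R' R0.
  have [h|h] := leP (2 * r) R'.
    apply: le_trans (H _ _ r0 h RR); rewrite ler_wpM2r//.
    by rewrite /K !ge_min lexx.
  apply: (@le_trans _ _ D^-1).
    apply: (@le_trans _ _ K); first by rewrite ler_piMr.
    by rewrite /K !ge_min lexx !orbT.
  rewrite ler_pdivlMr ?mball_gt0// mulrC ler_pdivrMr//.
  apply: (@le_trans _ _ (m x (2 * r))); first by apply: mball_le => //; exact: ltW.
  by have := doubling_iter x r 1 r0; rewrite !expr1 [leRHS]mulrC.
have [h|h] := leP (2 * r) R0.
  have h1 := H _ _ r0 h (lexx _).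
  apply: (@le_trans _ _ ((C * k1) * (r / R0) `^ p)).
    apply: ler_pM => //; first by rewrite /K !ge_min lexx !orbT.
    apply: ge0_ler_powR; rewrite ?nnegrE ?divr_ge0 ?(ltW p_gt0) ?(ltW r0) ?(ltW R'0) ?(ltW R0_gt0)//.
    by rewrite ler_pM2l// lef_pV2// ltW.
  rewrite mulrAC; apply: (@le_trans _ _ ((m x r / m x R0) * k1)).
    by rewrite ler_wpM2r// ltW.
  rewrite /k1 mulrA divfK ?gt_eqF ?mball_gt0//.
  rewrite ler_pM2l ?mball_gt0// lef_pV2 ?posrE ?mball_gt0//.
  exact: mball_le.
apply: (@le_trans _ _ k2).
  apply: (@le_trans _ _ K); first by rewrite ler_piMr.
  by rewrite /K !ge_min lexx !orbT.
apply: ler_pM; rewrite ?invr_ge0 ?(ltW (mball_gt0 _ _ _))// ?divr_gt0//.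
  by apply: mball_le; [rewrite divr_gt0|lra].
by rewrite lef_pV2 ?posrE ?mball_gt0//; exact: mball_le.
Qed.

End Growth.

(** * Elementary inequalities *)

Section RealLemmas.
Context {R : realType}.

(** One term is enough: the first when [t <= s], the second otherwise. The parameter [s] is left
    free and optimised after integration. *)
Lemma powR_le_young (a b s t : R) : 0 < a -> a < b -> 0 < s -> 0 <= t ->
  t `^ a <= s `^ a + s `^ (a - b) * t `^ b.
Proof.
move=> a0 ab s0 t0; have [ts|st] := leP t s.
  apply: (@le_trans _ _ (s `^ a)); last by rewrite lerDl mulr_ge0 ?powR_ge0.
  by apply: ge0_ler_powR; rewrite ?nnegrE ?(ltW a0) ?(ltW s0).
have tp : 0 < t by exact: lt_trans st.
apply: (@le_trans _ _ (s `^ (a - b) * t `^ b)); last by rewrite lerDr powR_ge0.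
rewrite (_ : t `^ a = t `^ (a - b) * t `^ b); last first.
  by rewrite -powRD ?subrK// (gt_eqF tp) implybT.
rewrite ler_wpM2r ?powR_ge0// -(opprB b a) !powRN lef_pV2 ?posrE ?powR_gt0//.
by apply: ge0_ler_powR; rewrite ?nnegrE ?subr_ge0 ?(ltW ab) ?(ltW s0) ?(ltW tp) ?(ltW st).
Qed.

(* optimal choice s = (I / m)^(1/b) in the family of Young inequalities *)
Lemma young_opt (a b f m I : R) : 0 < a -> a < b -> 0 <= f -> 0 < m -> 0 <= I ->
  (forall s, 0 < s -> f <= s `^ a * m + s `^ (a - b) * I) ->
  f <= 2 * (m `^ (1 - a / b) * I `^ (a / b)).
Proof.
move=> a0 ab f0 m0; have b0 : 0 < b by exact: lt_trans ab.
rewrite le_eqVlt => /predU1P[<-|I0] H.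
  rewrite powR0 ?gt_eqF ?divr_gt0// !mulr0.
  rewrite leNgt; apply/negP => fp.
  (* For [I = 0] there is no optimal [s]; this one turns the bound into [f <= f / 2]. *)
  pose s := (f / (2 * m)) `^ a^-1.
  have s0 : 0 < s by rewrite powR_gt0// divr_gt0// mulr_gt0.
  have := H s s0; rewrite mulr0 addr0 /s -powRrM mulVf ?gt_eqF// powRr1; last first.
    by rewrite divr_ge0// mulr_ge0// ltW.
  rewrite (_ : f / (2 * m) * m = f / 2); last by field; rewrite gt_eqF.
  lra.
pose s := (I / m) `^ b^-1.
have Im0 : 0 < I / m by rewrite divr_gt0.
have s0 : 0 < s by rewrite powR_gt0.
apply: le_trans (H s s0) _.
have mV e : (I / m) `^ e = I `^ e * m `^ (- e).
  by rewrite powRM ?invr_ge0 ?ltW// -powR_inv1 ?ltW// -powRrM mulN1r.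
have powne (v e1 e2 : R) : 0 < v -> v `^ e1 * v `^ e2 = v `^ (e1 + e2).
  by move=> v0; rewrite powRD// (gt_eqF v0) implybT.
have E1 : s `^ a * m = m `^ (1 - a / b) * I `^ (a / b).
  rewrite /s -powRrM [b^-1 * a]mulrC mV -mulrA [RHS]mulrC; congr (_ * _).
  by rewrite -{2}(powRr1 (ltW m0)) powne// addrC.
have E2 : s `^ (a - b) * I = m `^ (1 - a / b) * I `^ (a / b).
  rewrite /s -powRrM (_ : b^-1 * (a - b) = a / b - 1); last by field; rewrite gt_eqF.
  rewrite mV opprB mulrAC -{2}(powRr1 (ltW I0)) powne// subrK mulrC.
  by [].
by rewrite E1 E2; lra.
Qed.

(** After division by [a + b] both numbers lie in [0, 1], where c <= c^e. *)
Lemma powR_subadd (e a b : R) : 0 < e -> e <= 1 -> 0 <= a -> 0 <= b ->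
  (a + b) `^ e <= a `^ e + b `^ e.
Proof.
move=> e0 e1 a0 b0; have [ab0|ab0] := eqVneq (a + b) 0.
  by rewrite ab0 powR0 ?gt_eqF// addr_ge0 ?powR_ge0.
have ab : 0 < a + b by rewrite lt_neqAle eq_sym ab0 addr_ge0.
have frac c : 0 <= c -> c <= a + b -> c / (a + b) <= (c / (a + b)) `^ e.
  rewrite le_eqVlt => /predU1P[<- _|c0 cab]; first by rewrite mul0r powR_ge0.
  rewrite -{1}(powRr1 (_ : 0 <= c / (a + b))); last by rewrite divr_ge0 ?ltW.
  by apply: ger_powR => //; rewrite divr_gt0//= ler_pdivrMr// mul1r.
have cE c : 0 <= c -> c `^ e = (c / (a + b)) `^ e * (a + b) `^ e.
  by move=> c0; rewrite -powRM ?divfK ?divr_ge0 ?(ltW ab)// gt_eqF.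
rewrite (cE a)// (cE b)// -mulrDl -[leLHS]mul1r ler_wpM2r ?powR_ge0//.
rewrite (_ : 1 = a / (a + b) + b / (a + b)); last by rewrite -mulrDl divff.
by apply: lerD; apply: frac; rewrite ?lerDl ?lerDr.
Qed.

Lemma sum_contraction (tau : R) (s b : nat -> R) k : 0 <= tau -> 0 <= s k ->
  s 0%N <= b 0%N -> (forall n, (n < k)%N -> s n.+1 <= tau * s n + b n.+1) ->
  (1 - tau) * (\sum_(n < k.+1) s n) <= \sum_(n < k.+1) b n.
Proof.
move=> t0 sk s0 H.
(* The induction needs the extra summand [tau * s k]: it pays for the contribution of [s k] to the
   next term. *)
suff : (1 - tau) * (\sum_(n < k.+1) s n) + tau * s k <= \sum_(n < k.+1) b n.
  by apply: le_trans; rewrite lerDl mulr_ge0.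
elim: k H {sk} => [|k IH] H; first by rewrite !big_ord1; lra.
rewrite big_ord_recr [leRHS]big_ord_recr /=.
have := IH (fun n nk => H n (leqW nk)); have := H k (ltnSn k); lra.
Qed.

(** Hoelder for the counting measure: the Young inequality with exponents 1 and [p] is summed and
    then optimised. *)
Lemma sum_root_le (p : R) (I : nat -> R) k : 1 < p -> (forall n, 0 <= I n) ->
  \sum_(n < k.+1) I n `^ p^-1 <=
  2 * (k.+1%:R `^ (1 - p^-1) * (\sum_(n < k.+1) I n) `^ p^-1).
Proof.
move=> p1 I0; have p0 : 0 < p by exact: lt_trans p1.
have := @young_opt 1 p (\sum_(n < k.+1) I n `^ p^-1) k.+1%:R (\sum_(n < k.+1) I n).
rewrite div1r; apply => //.
- by apply: sumr_ge0 => n _; exact: powR_ge0.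
- by apply: sumr_ge0.
move=> s s0.
rewrite (_ : _ + _ = \sum_(n < k.+1) (s `^ 1 + s `^ (1 - p) * I n)); last first.
  by rewrite big_split/= sumr_const card_ord -mulr_sumr mulr_natr.
apply: ler_sum => n _.
have := powR_le_young 1 p s (I n `^ p^-1) ltr01 p1 s0 (powR_ge0 _ _).
rewrite [X in X <= _]powRr1 ?powR_ge0// -powRrM mulVf ?gt_eqF//.
by rewrite [I n `^ 1]powRr1.
Qed.

End RealLemmas.

(** * Hoelder's inequality between the exponents p0 and p *)

Section PowerIntegrals.
Context {R : realType} {dsp : measure_display} {X : measurableType dsp}.
Variables (mu : {measure set X -> \bar R}) (h : X -> \bar R) (p0 p : R).
Hypotheses (p0_gt0 : 0 < p0) (p0p : p0 < p).
Hypotheses (mh : measurable_fun setT h) (h0 : forall y, (0 <= h y)%E).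

Lemma measurable_pow (e : R) A : measurable_fun A (fun y => (h y `^ e)%E).
Proof.
by apply: measurable_funTS; exact: (measurableT_comp (measurable_poweR _)).
Qed.

Lemma poweR_le_young s y : 0 < s ->
  (h y `^ p0 <= (s `^ p0)%:E + (s `^ (p0 - p))%:E * h y `^ p)%E.
Proof.
move=> s0; have pp : 0 < p by exact: lt_trans p0p.
case: (h y) (h0 y) => [t|_|//].
  by rewrite lee_fin => t0; rewrite !poweR_EFin -EFinM -EFinD lee_fin powR_le_young.
rewrite !poweRyr ?gt_eqF// gt0_muley ?lte_fin ?powR_gt0//.
Qed.

Lemma integral_pow_young s A : measurable A -> 0 < s ->
  (\int[mu]_(y in A) (h y `^ p0) <=
    (s `^ p0)%:E * mu A + (s `^ (p0 - p))%:E * \int[mu]_(y in A) (h y `^ p))%E.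
Proof.
move=> mA s0.
rewrite -integral_cst// -ge0_integralZl_EFin ?powR_ge0//; last 2 first.
- by move=> y _; exact: poweR_ge0.
- exact: measurable_pow.
rewrite -ge0_integralD//; last 3 first.
- by move=> y _; rewrite lee_fin powR_ge0.
- by move=> y _; rewrite mule_ge0 ?poweR_ge0// lee_fin powR_ge0.
- by apply: measurable_funeM; exact: measurable_pow.
apply: ge0_le_integral => //.
- by move=> y _; exact: poweR_ge0.
- exact: measurable_pow.
- by apply: emeasurable_funD => //; apply: measurable_funeM; exact: measurable_pow.
- by move=> y _; exact: poweR_le_young.
Qed.

Hypothesis hI : (\int[mu]_y (h y `^ p) < +oo)%E.

Lemma integral_pow_fin A : measurable A ->
  (\int[mu]_(y in A) (h y `^ p))%E \is a fin_num.
Proof.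
move=> mA; rewrite ge0_fin_numE; last by apply: integral_ge0 => y _; exact: poweR_ge0.
apply: le_lt_trans hI; apply: ge0_subset_integral => //.
  exact: measurable_pow.
by move=> y _; exact: poweR_ge0.
Qed.

Lemma integral_pow0_fin A : measurable A -> (mu A < +oo)%E ->
  (\int[mu]_(y in A) (h y `^ p0))%E \is a fin_num.
Proof.
move=> mA Aoo; rewrite ge0_fin_numE; last by apply: integral_ge0 => y _; exact: poweR_ge0.
apply: le_lt_trans (integral_pow_young 1 _ mA ltr01) _.
rewrite !powR1 !mul1e lte_add_pinfty//.
by have := integral_pow_fin A mA; rewrite ge0_fin_numE// integral_ge0// => y _; exact: poweR_ge0.
Qed.

(** The upper bound [M] takes the place of the measure of [A], since an annulus may be null while
    the optimisation needs a positive number; the measure of the surrounding ball will be used. *)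
Lemma integral_pow_hoelder A (M : R) : measurable A -> 0 < M -> (mu A <= M%:E)%E ->
  fine (\int[mu]_(y in A) (h y `^ p0))%E <=
  2 * (M `^ (1 - p0 / p) * fine (\int[mu]_(y in A) (h y `^ p))%E `^ (p0 / p)).
Proof.
move=> mA M0 AM.
have Aoo : (mu A < +oo)%E by apply: le_lt_trans AM _; rewrite ltry.
apply: young_opt => //.
- by apply: fine_ge0; apply: integral_ge0 => y _; exact: poweR_ge0.
- by apply: fine_ge0; apply: integral_ge0 => y _; exact: poweR_ge0.
move=> s s0; rewrite -lee_fin fineK ?integral_pow0_fin//.
apply: le_trans (integral_pow_young s _ mA s0) _.
rewrite EFinD !EFinM fineK ?integral_pow_fin//.
by apply: leeD => //; apply: lee_wpmul2l => //; rewrite lee_fin powR_ge0.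
Qed.

End PowerIntegrals.

Section Averages.
Context {R : realType} {dsp : measure_display} {X : measurableType dsp}.
Variables (mu : {measure set X -> \bar R}).

Lemma average_diff_le (u : X -> R) (U V : set X) (a : R) :
  measurable U -> measurable V -> U `<=` V -> (0 < mu U)%E -> (mu V < +oo)%E ->
  mu.-integrable setT (EFin \o u) ->
  ((`|fine (\int[mu]_(y in U) (u y)%:E)%E / fine (mu U) - a| * fine (mu U))%:E <=
   \int[mu]_(y in V) (`|u y - a|)%:E)%E.
Proof.
move=> mU mV UV U0 Voo iu.
have Uoo : (mu U < +oo)%E.
  by apply: le_lt_trans Voo; apply: le_measure; rewrite ?inE.
have mU0 : 0 < fine (mu U) by rewrite fine_gt0// U0.
have iuU : mu.-integrable U (EFin \o u) by exact: integrableS iu.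
have icU : mu.-integrable U (EFin \o cst a).
  by apply/integrableP; split; [exact/measurable_EFinP|
    rewrite /= integral_cst// lte_mul_pinfty// ltry].
have iB : mu.-integrable U (EFin \o (fun y => u y - a)).
  exact: (integrableB mU iuU icU).
have E : (fine (\int[mu]_(y in U) (u y)%:E)%E / fine (mu U) - a) * fine (mu U) =
    (\int[mu]_(y in U) (u y - a))%R.
  rewrite RintegralB// Rintegral_cst// mulrBl divfK// gt_eqF//.
have -> : `|fine (\int[mu]_(y in U) (u y)%:E)%E / fine (mu U) - a| * fine (mu U) =
    `|(\int[mu]_(y in U) (u y - a))%R|.
  by rewrite -E normrM (gtr0_norm mU0).
apply: (@le_trans _ _ (\int[mu]_(y in U) (`|u y - a|)%:E)%E); last first.
  apply: ge0_subset_integral => //.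
  apply/measurable_EFinP; apply: measurableT_comp => //; apply: measurable_funB => //.
  by apply: measurable_funTS; apply/measurable_EFinP; exact: (measurable_int mu).
have := le_normr_Rintegral mU iB; rewrite -lee_fin => /le_trans; apply.
rewrite /Rintegral fineK//; apply: integrable_fin_num => //.
exact: (integrable_norm iB).
Qed.

End Averages.

(** * Telescoping along concentric balls *)

Section Chain.
Context {R : realType} {dsp : measure_display} {X : measurableType dsp}.
Variables (d : X -> X -> R) (mu : {measure set X -> \bar R}).
Hypothesis dm : is_metric d.
Hypothesis mopen : forall U : set X, d_open d U -> measurable U.
Hypothesis mball : forall (y : X) (r : R), 0 < r ->
  (0 < mu (dball d y r) < +oo)%E.
Variables (x z : X) (R0 p0 p D Cp lam : R) (L : nat).
Hypotheses (p01 : 1 <= p0) (p0p : p0 < p).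
Hypothesis far : 2 * R0 < d x z.
Hypothesis D1 : 1 < D.
Hypothesis doub : forall y (r : R), 0 < r ->
    (mu (dball d y (2 * r)) <= D%:E * mu (dball d y r))%E.
Hypotheses (Cp1 : 1 <= Cp) (lam1 : 1 <= lam).
Hypothesis poin : forall (y : X) (r : R) (f : X -> R) (g : X -> \bar R), 0 < r ->
  mu.-integrable setT (EFin \o f) -> upper_gradient d f g ->
  let B := dball d y r in
  let mB := fine (mu B) in
  let fB := (fine (\int[mu]_(z in B) (f z)%:E)%E / mB) in
  (\int[mu]_(z in B) (`|f z - fB|)%:E <=
    (Cp * r * mB)%:E *
    ((((fine (mu (dball d y (lam * r))))^-1)%:E *
      \int[mu]_(z in dball d y (lam * r)) (g z `^ p0)) `^ p0^-1))%E.
Hypotheses (L2 : (2 <= L)%N) (lamL : lam <= 2 ^+ L).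

Let m r := fine (mu (dball d x r)).
Let p0_gt0 : 0 < p0. Proof. exact: lt_le_trans p01. Qed.
Let p_gt0 : 0 < p. Proof. exact: lt_trans p0p. Qed.
(** [beta] is the gain of Hoelder between the two exponents, [theta] the reverse doubling factor,
    and [DL] the doubling constant for dilation by [Lam]. The ratio [Lam] of consecutive radii is at
    least [lam], so that a dilated ball lies in the next one, and at least 4, as reverse doubling
    requires. *)
Let beta := p0^-1 - p^-1.
Let theta := 1 - (D ^+ 4)^-1.
Let DL := D ^+ L.
Let Lam : R := 2 ^+ L.

Let beta_gt0 : 0 < beta.
Proof. by rewrite subr_gt0 ltf_pV2 ?posrE. Qed.

Let D_gt0 : 0 < D. Proof. exact: lt_trans D1. Qed.

Let theta01 : 0 < theta < 1.
Proof.
rewrite /theta subr_gt0 invf_lt1 ?exprn_gt0// exprn_egt1//=.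
by rewrite ltrBlDr ltrDl invr_gt0 exprn_gt0.
Qed.

Variables (r R' : R) (k : nat) (u : X -> R) (h : X -> \bar R).
Hypotheses (r0 : 0 < r) (R'0 : 0 < R') (R'R0 : R' <= R0).
Let rad n : R := Lam ^+ n * r.
Let Bn n := dball d x (rad n).
Let mn n := m (rad n).
Hypotheses (kR : R' <= rad k) (kmin : forall n, (n < k)%N -> rad n <= R0).
Hypotheses (meas_u : measurable_fun setT u) (u01 : forall y, 0 <= u y <= 1).
Hypothesis u1 : forall y, dball d x r y -> u y = 1.
Hypothesis u0 : forall y, ~ dball d x R' y -> u y = 0.
Hypothesis ug : upper_gradient d u h.
Hypothesis h_off : forall y, ~ dball d x R' y -> h y = 0%E.
Hypothesis hI : (\int[mu]_y (h y `^ p) < +oo)%E.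

Let Lam4 : 4 <= Lam.
Proof. by rewrite /Lam (_ : 4 = 2 ^+ 2) ?ler_eXn2l ?ltr1n//; ring. Qed.
Let Lam_gt0 : 0 < Lam. Proof. by rewrite exprn_gt0. Qed.
Let rad_gt0 n : 0 < rad n. Proof. by rewrite mulr_gt0// exprn_gt0. Qed.
Let radS n : rad n.+1 = Lam * rad n. Proof. by rewrite /rad exprS mulrA. Qed.
Let rad_le n : rad n <= rad n.+1.
Proof. by rewrite radS ler_peMl ?(ltW (rad_gt0 n))// (le_trans _ Lam4)// ler1n. Qed.
Let rad_leD i j : (i <= j)%N -> rad i <= rad j.
Proof.
move=> ij; rewrite -(subnKC ij); elim: (j - i)%N => [|n IH]; first by rewrite addn0.
by apply: le_trans IH _; rewrite addnS.
Qed.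
Let mn_gt0 n : 0 < mn n. Proof. exact: mball_gt0. Qed.
Let mn_le i j : (i <= j)%N -> mn i <= mn j.
Proof. by move=> ij; apply: mball_le => //; exact: rad_leD. Qed.
Let mnS_le n : mn n.+1 <= DL * mn n.
Proof. by rewrite /mn radS; exact: (doubling_iter _ _ mball _ (ltW D1) doub). Qed.
Let mnE n : mu (Bn n) = (mn n)%:E.
Proof. exact: mu_dballE. Qed.
Let mBn n : measurable (Bn n). Proof. exact: dball_measurable. Qed.
Let Bn_sub i j : (i <= j)%N -> Bn i `<=` Bn j.
Proof. by move=> ij y /lt_le_trans; apply; exact: rad_leD. Qed.

Let mh : measurable_fun setT h.
Proof. by case: ug => bh _ _; exact: borel_measurable_fun bh. Qed.
Let h0 y : (0 <= h y)%E. Proof. by case: ug. Qed.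

Let iu : mu.-integrable setT (EFin \o u).
Proof.
apply/integrableP; split; first exact/measurable_EFinP.
apply: (@le_lt_trans _ _ (\int[mu]_y (\1_(Bn k) y)%:E)%E); last first.
  by rewrite integral_indic// setIT mnE ltry.
apply: ge0_le_integral => //.
- by apply: measurableT_comp => //; exact/measurable_EFinP.
- by apply/measurable_EFinP; exact: measurable_indic.
move=> y _; rewrite /= lee_fin indicE; case/andP: (u01 y) => uy0 uy1.
rewrite ger0_norm//; case: (boolP (_ \in _)) => yB //.
rewrite u0 // => yR; move: yB; rewrite mem_set// /Bn.
by apply: lt_le_trans yR _.
Qed.

Let F n := fine (\int[mu]_(y in Bn n) (h y `^ p0))%E.
Let J n := fine (\int[mu]_(y in Bn n) (h y `^ p))%E.
Let avg n := fine (\int[mu]_(y in Bn n) (u y)%:E)%E / mn n.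

Let FE n : (\int[mu]_(y in Bn n) (h y `^ p0))%E = (F n)%:E.
Proof. by rewrite fineK// (integral_pow0_fin _ _ _ p)// mnE ltry. Qed.
Let F_ge0 n : 0 <= F n.
Proof. by apply: fine_ge0; apply: integral_ge0 => y _; exact: poweR_ge0. Qed.

(** The Poincare inequality is used on the ball [n.+1]: the smaller ball has comparable measure,
    which costs [DL], and the dilated ball lies in the ball [n.+2], which explains the index of
    [F]. *)
Lemma average_step n : `|avg n - avg n.+1| <=
  DL * Cp * (rad n.+1 * (F n.+2 / mn n.+1) `^ p0^-1).
Proof.
have := @average_diff_le _ _ _ mu u (Bn n) (Bn n.+1) (avg n.+1) (mBn n) (mBn _)
  (Bn_sub _ _ (leqnSn n)).
rewrite !mnE lte_fin ltry => /(_ (mn_gt0 n) isT iu); rewrite -/(avg n).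
have := poin x _ u h (rad_gt0 n.+1) iu ug; cbv zeta.
rewrite -/(Bn _) -[fine (mu (Bn n.+1))]/(mn n.+1) -/(avg n.+1).
move=> H1 /le_trans /(_ H1) {H1}.
set I := (\int[mu]_(y in dball d x (lam * rad n.+1)) _)%E.
have lr : rad n.+1 <= lam * rad n.+1 by apply: ler_peMl => //; exact: ltW.
have lrp : 0 < lam * rad n.+1 by exact: lt_le_trans lr.
have IF : (I <= (F n.+2)%:E)%E.
  rewrite -FE; apply: ge0_subset_integral => //.
  - exact: dball_measurable.
  - exact: measurable_pow.
  - by move=> y _; exact: poweR_ge0.
  - by move=> y /lt_le_trans; apply; rewrite (radS n.+1) ler_pM2r.
have I0 : (0 <= I)%E by apply: integral_ge0 => y _; exact: poweR_ge0.
have H2 : ((fine (mu (dball d x (lam * rad n.+1))))^-1%:E * I <= (F n.+2 / mn n.+1)%:E)%E.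
  rewrite (mulrC (F _)) EFinM; apply: lee_pmul => //.
  rewrite lee_fin lef_pV2 ?posrE ?mn_gt0 ?mball_gt0//; exact: mball_le.
have H3 : (((fine (mu (dball d x (lam * rad n.+1))))^-1%:E * I) `^ p0^-1 <=
    ((F n.+2 / mn n.+1) `^ p0^-1)%:E)%E.
  rewrite -poweR_EFin; apply: gt0_ler_poweR => //.
  - by rewrite invr_ge0 ltW.
  - rewrite in_itv/= leey andbT mule_ge0// lee_fin invr_ge0 ltW// mball_gt0//.
  - by rewrite in_itv/= leey andbT lee_fin divr_ge0// ltW.
have Cge : (0 <= (Cp * rad n.+1 * mn n.+1)%:E)%E.
  rewrite lee_fin; apply: mulr_ge0; last exact: ltW.
  by apply: mulr_ge0; [exact: (le_trans ler01 Cp1)|exact: ltW].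
move=> /le_trans /(_ (lee_wpmul2l Cge H3)); rewrite -EFinM lee_fin /= => {}H3.
rewrite -(ler_pM2r (mn_gt0 n)); apply: (le_trans H3).
rewrite (_ : DL * Cp * (rad n.+1 * (F n.+2 / mn n.+1) `^ p0^-1) * mn n =
  Cp * rad n.+1 * (DL * mn n) * (F n.+2 / mn n.+1) `^ p0^-1); last by ring.
rewrite ler_wpM2r ?powR_ge0// ler_wpM2l//.
by apply: mulr_ge0; [exact: (le_trans ler01 Cp1)|exact: ltW].
Qed.

(** On the ball 0 the mean is 1. The function lives in the ball of radius [R'], while [rad k.+1] is
    at least [4 * R'], so reverse doubling bounds the last mean by [theta]. *)
Lemma average_ends : (D ^+ 4)^-1 <= avg 0 - avg k.+1.
Proof.
have -> : avg 0 = 1.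
  have E0 : (\int[mu]_(y in Bn 0) (u y)%:E)%E = (mn 0)%:E.
    transitivity (\int[mu]_(y in Bn 0) (cst 1%E y))%E.
      by apply: eq_integral => y; rewrite inE /Bn /rad expr0 mul1r => yB; rewrite u1.
    by rewrite integral_cst// mul1e mnE.
  by rewrite /avg E0 divff// (gt_eqF (mn_gt0 0)).
suff : avg k.+1 <= theta by rewrite /theta; lra.
rewrite /avg ler_pdivrMr//.
have h1 : m R' <= theta * mn k.+1.
  apply: le_trans (reverse_doubling d mu dm mopen mball x z R0 p0 D _ _ far _ doub _ R'0 R'R0) _.
  - exact: p01.
  - by exists Cp, lam.
  - exact: ltW.
  rewrite -/theta ler_pM2l; last by case/andP: theta01.
  by apply: mball_le; rewrite ?mulr_gt0// radS ler_pM// ltW.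
apply: le_trans h1.
rewrite -lee_fin fineK; last first.
  by apply: integrable_fin_num => //; exact: integrableS iu.
have -> : (m R')%:E = (\int[mu]_y (\1_(dball d x R') y)%:E)%E.
  rewrite integral_indic//; last exact: dball_measurable.
  by rewrite setIT (mu_dballE _ _ _ mball).
apply: (@le_trans _ _ (\int[mu]_y (u y)%:E)%E).
  apply: ge0_subset_integral => //; first exact/measurable_EFinP.
  by move=> y _; rewrite lee_fin; case/andP: (u01 y).
apply: ge0_le_integral => //.
- by move=> y _; rewrite lee_fin; case/andP: (u01 y).
- exact/measurable_EFinP.
- by apply/measurable_EFinP; apply: measurable_indic; exact: dball_measurable.
move=> y _; rewrite lee_fin indicE; case: (boolP (_ \in _)) => yB.
  by case/andP: (u01 y).
rewrite u0// => yR; move: yB; rewrite mem_set//.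
Qed.

Lemma telescope_le : (D ^+ 4)^-1 <= \sum_(n < k.+1)
  DL * Cp * (rad n.+1 * (F n.+2 / mn n.+1) `^ p0^-1).
Proof.
apply: (le_trans average_ends).
apply: (@le_trans _ _ (\sum_(n < k.+1) `|avg n - avg n.+1|)); last first.
  by apply: ler_sum => n _; exact: average_step.
elim: k.+1 => [|n IH]; first by rewrite big_ord0 subrr.
rewrite big_ord_recr/=; apply: le_trans (lerD IH (ler_norm _)).
lra.
Qed.

(** * Annular energies and the contraction *)

Let Ann n := if n is n'.+1 then Bn n `\` Bn n' else Bn 0.
Let f n := fine (\int[mu]_(y in Ann n) (h y `^ p0))%E.
Let I n := fine (\int[mu]_(y in Ann n) (h y `^ p))%E.
Let s n := F n `^ p0^-1 * mn n `^ (- beta).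
Let tau := theta `^ beta.

Let mAnn n : measurable (Ann n).
Proof. by case: n => [|n]; [exact: mBn|apply: measurableD]. Qed.
Let Ann_sub n : Ann n `<=` Bn n. Proof. by case: n => // n y []. Qed.
Let f_ge0 n : 0 <= f n.
Proof. by apply: fine_ge0; apply: integral_ge0 => y _; exact: poweR_ge0. Qed.
Let I_ge0 n : 0 <= I n.
Proof. by apply: fine_ge0; apply: integral_ge0 => y _; exact: poweR_ge0. Qed.
Let scaled_norm_ge0 n : 0 <= s n. Proof. by rewrite mulr_ge0 ?powR_ge0. Qed.

Let powRDp (v a b : R) : 0 < v -> v `^ (a + b) = v `^ a * v `^ b.
Proof. by move=> v0; rewrite powRD// (gt_eqF v0) implybT. Qed.

(** The power of [mn n] produced by Hoelder is exactly cancelled by the normalisation -[beta]; the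
    constant 2^(1/p0) is at most 2. *)
Lemma annulus_hoelder n : f n `^ p0^-1 * mn n `^ (- beta) <= 2 * I n `^ p^-1.
Proof.
have Am : (mu (Ann n) <= (mn n)%:E)%E.
  by rewrite -mnE; apply: le_measure; rewrite ?inE.
have H := integral_pow_hoelder mu h p0 p p0_gt0 p0p mh h0 hI _ _ (mAnn n) (mn_gt0 n) Am.
have m0 := ltW (mn_gt0 n).
have H1 : f n `^ p0^-1 <= 2 * (mn n `^ beta * I n `^ p^-1).
  apply: (@le_trans _ _ ((2 * (mn n `^ (1 - p0 / p) * I n `^ (p0 / p))) `^ p0^-1)).
    apply: ge0_ler_powR; rewrite ?nnegrE ?f_ge0 ?invr_ge0 ?(ltW p0_gt0)//.
    by apply: mulr_ge0 => //; apply: mulr_ge0; exact: powR_ge0.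
  have -> : (2 * (mn n `^ (1 - p0 / p) * I n `^ (p0 / p))) `^ p0^-1 =
      2 `^ p0^-1 * (mn n `^ beta * I n `^ p^-1).
    rewrite powRM//; last by apply: mulr_ge0; exact: powR_ge0.
    rewrite powRM ?powR_ge0// -!powRrM.
    have -> : (1 - p0 / p) / p0 = beta.
      by rewrite /beta; field; rewrite !gt_eqF.
    by have -> : p0 / p / p0 = p^-1 by field; rewrite !gt_eqF.
  rewrite ler_wpM2r ?mulr_ge0 ?powR_ge0//.
  by apply: ler1_powR; rewrite ?ler1n// invf_le1.
have := ler_wpM2r (powR_ge0 (mn n) (- beta)) H1 => /le_trans; apply.
rewrite -mulrA [_ * mn n `^ (- beta)]mulrAC -powRDp// subrr powRr0 mul1r.
by [].
Qed.

Let FS n : F n.+1 = F n + f n.+1.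
Proof.
apply: EFin_inj; rewrite EFinD -!FE /f fineK; last first.
  apply: (integral_pow0_fin mu h p0 p) => //.
  apply: (@le_lt_trans _ _ (mu (Bn n.+1))); last by rewrite mnE ltry.
  by apply: le_measure; rewrite ?inE.
have U : Bn n `|` (Bn n.+1 `\` Bn n) = Bn n.+1.
  by apply: setDUK; exact: Bn_sub.
rewrite -{1}U ge0_integral_setU//.
- exact: measurableD.
- by apply: measurable_pow.
- by move=> y _; exact: poweR_ge0.
- by rewrite disj_set2E setDIK.
Qed.

Let sum_I n : \sum_(i < n.+1) I i = J n.
Proof.
elim: n => [|n IH]; first by rewrite big_ord1.
rewrite big_ord_recr/= IH; apply: EFin_inj; rewrite EFinD /J /I.
rewrite !fineK; [|exact: (integral_pow_fin mu h p)..].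
have U : Bn n `|` (Bn n.+1 `\` Bn n) = Bn n.+1.
  by apply: setDUK; exact: Bn_sub.
rewrite -{1}U ge0_integral_setU//.
- exact: measurableD.
- by apply: measurable_pow.
- by move=> y _; exact: poweR_ge0.
- by rewrite disj_set2E setDIK.
Qed.

(** The power 1/p0 is subadditive, which splits off the annulus. Replacing [mn n.+1] by [mn n] in
    the normalisation gains [tau]; reverse doubling needs [rad n <= R0], hence [n < k]. *)
Lemma scaled_norm_step n : (n < k)%N -> s n.+1 <= tau * s n + 2 * I n.+1 `^ p^-1.
Proof.
move=> nk; have [t0 _] := andP theta01.
have mth : mn n <= theta * mn n.+1.
  apply: le_trans (reverse_doubling d mu dm mopen mball x z R0 p0 D _ _ far _ doub _ _ (kmin _ nk)) _ => //.
  - by exists Cp, lam.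
  - exact: ltW.
  rewrite -/theta ler_pM2l//; apply: mball_le => //; first by rewrite mulr_gt0.
  by rewrite radS ler_pM2r.
have mb : mn n.+1 `^ (- beta) <= tau * mn n `^ (- beta).
  rewrite !powRN ler_pdivlMr ?powR_gt0// mulrC ler_pdivrMr ?powR_gt0// /tau.
  rewrite -powRM ?(ltW t0) ?(ltW (mn_gt0 _))//.
  apply: ge0_ler_powR; rewrite ?nnegrE ?(ltW beta_gt0)//; first exact: ltW.
  by apply: mulr_ge0; exact: ltW.
rewrite {1}/s FS.
have pV : 0 < p0^-1 by rewrite invr_gt0.
have pV1 : p0^-1 <= 1 by rewrite invf_le1.
apply: (@le_trans _ _ ((F n `^ p0^-1 + f n.+1 `^ p0^-1) * mn n.+1 `^ (- beta))).
  by rewrite ler_wpM2r ?powR_ge0//; exact: powR_subadd.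
rewrite mulrDl; apply: lerD; last exact: annulus_hoelder.
by rewrite /s mulrCA; apply: ler_wpM2l; rewrite ?powR_ge0.
Qed.

(** From scale [k] on, where the contraction is not at hand, [h] contributes no further energy and
    the measures only grow. *)
Lemma scaled_norm_tail n : (k <= n)%N -> s n <= s k.
Proof.
move=> kn; have Fnk : F n = F k.
  apply: EFin_inj; rewrite -!FE.
  have U : Bn k `|` (Bn n `\` Bn k) = Bn n by apply: setDUK; exact: Bn_sub.
  rewrite -{1}U ge0_integral_setU//.
  - rewrite [X in (_ + X)%E]integral0_eq ?adde0// => y [_ yk].
    rewrite h_off ?poweR0r ?gt_eqF// => yR; apply: yk.
    exact: lt_le_trans kR.
  - exact: measurableD.
  - by apply: measurable_pow.
  - by move=> y _; exact: poweR_ge0.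
  - by rewrite disj_set2E setDIK.
rewrite /s Fnk; apply: ler_wpM2l; first exact: powR_ge0.
rewrite !powRN lef_pV2 ?posrE ?powR_gt0//.
apply: ge0_ler_powR; rewrite ?nnegrE ?(ltW beta_gt0)//; try exact: ltW.
exact: mn_le.
Qed.

Lemma sum_scaled_norm_le : \sum_(n < k.+1) s n.+2 <=
  3 / (1 - tau) * (4 * (k.+1%:R `^ (1 - p^-1) * J k `^ p^-1)).
Proof.
have [t0 t1] := andP theta01.
have tau1 : 0 < 1 - tau.
  rewrite subr_gt0 /tau (_ : 1 = 1 `^ beta); last by rewrite powR1.
  by apply: gt0_ltr_powR; rewrite ?nnegrE// ltW.
(* The chain uses the indices 2 to [k.+2]; the last two terms are each at most [s k], hence the
   factor 3. *)
have S1 : \sum_(n < k.+1) s n.+2 <= 3 * \sum_(n < k.+1) s n.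
  apply: (@le_trans _ _ (\sum_(n < k.+3) s n)).
    have -> : \sum_(n < k.+3) s n = s 0 + (s 1 + \sum_(n < k.+1) s n.+2).
      by rewrite 2!big_ord_recl.
    by rewrite addrA lerDr addr_ge0.
  rewrite 2!big_ord_recr/=.
  have sk : s k <= \sum_(n < k.+1) s n.
    by rewrite big_ord_recr/= lerDr sumr_ge0.
  have := scaled_norm_tail k.+1 (leqnSn _); have := scaled_norm_tail k.+2 (leqW (leqnSn _)); lra.
apply: (le_trans S1).
rewrite -!mulrA ler_pM2l// ler_pdivlMl//.
apply: le_trans (sum_contraction tau s (fun n => 2 * I n `^ p^-1) k _ _ _ _) _ => //.
- exact: powR_ge0.
- exact: (annulus_hoelder 0).
- exact: scaled_norm_step.
rewrite -mulr_sumr (_ : 4 = 2 * 2 :> R); last by ring.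
rewrite -[leRHS]mulrA ler_pM2l// -sum_I; apply: sum_root_le => //.
exact: le_lt_trans p0p.
Qed.

(** Since 1/p0 = 1/p + [beta], the term factors into a power of mu(B)/rad^p, bounded through [a],
    and a scaled norm. Moving the normalisation from ball [j] to ball [j.+1] costs the power [beta]
    of [DL]. *)
Lemma chain_term_le (a : R) j : rad j * mn j `^ (- p^-1) <= a ->
  rad j * (F j.+1 / mn j) `^ p0^-1 <= a * (DL `^ beta * s j.+1).
Proof.
move=> ha; have m0 := mn_gt0 j; have m1 := mn_gt0 j.+1.
have -> : rad j * (F j.+1 / mn j) `^ p0^-1 =
    (rad j * mn j `^ (- p^-1)) * (F j.+1 `^ p0^-1 * mn j `^ (- beta)).
  rewrite powRM ?F_ge0 ?invr_ge0 ?(ltW m0)// -(powR_inv1 (ltW m0)) -powRrM.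
  rewrite (_ : -1 * p0^-1 = - p^-1 + - beta); last by rewrite /beta; ring.
  by rewrite powRDp//; ring.
apply: ler_pM => //.
- by apply: mulr_ge0; [exact: ltW|exact: powR_ge0].
- by apply: mulr_ge0; exact: powR_ge0.
rewrite /s mulrCA; apply: ler_wpM2l; first exact: powR_ge0.
have DL0 : 0 < DL by rewrite exprn_gt0.
rewrite !powRN ler_pdivlMr ?powR_gt0// mulrC ler_pdivrMr ?powR_gt0//.
rewrite -powRM ?(ltW DL0) ?(ltW m0)//.
apply: ge0_ler_powR; rewrite ?nnegrE ?(ltW beta_gt0)//; first exact: ltW.
by apply: mulr_ge0; exact: ltW.
Qed.

Lemma chain_estimate (a : R) : 0 <= a ->
  (forall j, (j <= k.+1)%N -> rad j * mn j `^ (- p^-1) <= a) ->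
  (D ^+ 4)^-1 <= (DL * Cp * (DL `^ beta) * (3 / (1 - tau)) * 4) *
    (a * (k.+1%:R `^ (1 - p^-1) * J k `^ p^-1)).
Proof.
move=> a0 ha; apply: (le_trans telescope_le).
rewrite -mulr_sumr -!mulrA.
have DL0 : 0 <= DL by rewrite exprn_ge0// ltW.
apply: ler_wpM2l => //; apply: ler_wpM2l; first exact: le_trans Cp1.
apply: (@le_trans _ _ (\sum_(n < k.+1) a * (DL `^ beta * s n.+2))).
  by apply: ler_sum => n _; apply: chain_term_le; apply: ha.
rewrite -!mulr_sumr.
have H := sum_scaled_norm_le.
have A0 : 0 <= a * DL `^ beta by rewrite mulr_ge0 ?powR_ge0.
apply: (@le_trans _ _ (a * DL `^ beta *
  (3 / (1 - tau) * (4 * (k.+1%:R `^ (1 - p^-1) * J k `^ p^-1))))).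
  by rewrite mulrA; exact: ler_wpM2l.
by rewrite le_eqVlt; apply/orP; left; apply/eqP; ring.
Qed.

End Chain.

(** * Lower bounds for the capacity *)

(** Solves the chain estimate for the energy: the p-th power turns N^(1 - 1/p) into N^(p-1), which
    crosses over as N^(1-p). *)
Lemma chain_estimate_pow {R : realType} (p del K A N J : R) : 1 < p -> 0 < del ->
  0 < K -> 0 < A -> 0 < N -> 0 <= J ->
  del <= K * (A `^ (- p^-1) * (N `^ (1 - p^-1) * J `^ p^-1)) ->
  A * N `^ (1 - p) <= (K / del) `^ p * J.
Proof.
move=> p1 d0 K0 A0 N0 J0 H; have p0 : 0 < p by exact: lt_trans p1.
have pn : p != 0 by rewrite gt_eqF.
have h : del `^ p <= K `^ p * (A^-1 * (N `^ (p - 1) * J)).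
  apply: (@le_trans _ _ ((K * (A `^ (- p^-1) * (N `^ (1 - p^-1) * J `^ p^-1))) `^ p)).
    apply: ge0_ler_powR; rewrite ?nnegrE ?(ltW p0) ?(ltW d0)//.
    exact: le_trans (ltW d0) H.
  rewrite powRM ?(ltW K0) ?mulr_ge0 ?powR_ge0// ler_pM2l ?powR_gt0//.
  rewrite !powRM ?mulr_ge0 ?powR_ge0// -!powRrM mulNr mulVf// powR_inv1 ?(ltW A0)//.
  rewrite powRr1// (_ : (1 - p^-1) * p = p - 1)//; by field.
rewrite powRM ?invr_ge0 ?(ltW K0) ?(ltW d0)//.
rewrite -(powR_inv1 (ltW d0)) -powRrM mulN1r powRN mulrAC ler_pdivlMr ?powR_gt0//.
have AN : 0 <= A * N `^ (1 - p) by rewrite mulr_ge0 ?powR_ge0 ?(ltW A0).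
apply: (le_trans (ler_wpM2l AN h)).
have NN : N `^ (1 - p) * N `^ (p - 1) = 1.
  rewrite -powRD; last by rewrite (gt_eqF N0) implybT.
  by rewrite (_ : 1 - p + (p - 1) = 0) ?powRr0//; ring.
rewrite [leLHS](_ : _ = (A * A^-1) * (N `^ (1 - p) * N `^ (p - 1)) * (K `^ p * J)); last by ring.
by rewrite NN divff ?gt_eqF// !mul1r.
Qed.

Lemma ln2_ge_half {R : realType} : 2^-1 <= ln 2 :> R.
Proof.
have := @le_ln1Dx R (- 2^-1); rewrite ltrN2 invf_lt1// ltr1n => /(_ isT).
rewrite (_ : 1 + - 2^-1 = 2^-1 :> R); last by field.
by rewrite lnV ?posrE// lerN2.
Qed.

Section LowerBound.
Context {R : realType} {dsp : measure_display} {X : measurableType dsp}.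
Variables (d : X -> X -> R) (mu : {measure set X -> \bar R}).
Hypothesis dm : is_metric d.
Hypothesis mopen : forall U : set X, d_open d U -> measurable U.
Hypothesis mball : forall (y : X) (r : R), 0 < r ->
  (0 < mu (dball d y r) < +oo)%E.
Variables (x z : X) (R0 p0 p D : R).
Hypotheses (p01 : 1 <= p0) (p0p : p0 < p).
Hypothesis far : 2 * R0 < d x z.
Hypothesis D1 : 1 < D.
Hypothesis doub : forall y (r : R), 0 < r ->
    (mu (dball d y (2 * r)) <= D%:E * mu (dball d y r))%E.
Hypothesis poin : global_poincare d mu p0.

Let m r := fine (mu (dball d x r)).
Let p1 : 1 < p. Proof. exact: le_lt_trans p0p. Qed.
Let p_gt0 : 0 < p. Proof. exact: lt_trans p1. Qed.

Lemma energy_lower_bound : exists C : R, 0 < C /\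
  forall (r R' A : R) (u : X -> R) (h : X -> \bar R),
  0 < r -> 2 * r <= R' -> R' <= R0 -> 0 < A ->
  (forall rho : R, r <= rho -> rho <= R' -> A <= m rho / rho `^ p) ->
  measurable_fun setT u -> (forall y, 0 <= u y <= 1) ->
  (forall y, dball d x r y -> u y = 1) ->
  (forall y, ~ dball d x R' y -> u y = 0) ->
  upper_gradient d u h -> (forall y, ~ dball d x R' y -> h y = 0%E) ->
  ((A * ln (R' / r) `^ (1 - p))%:E <= C%:E * \int[mu]_y (h y `^ p))%E.
Proof.
case: poin => Cp [lam [Cp1 lam1 H]].
have [L L2 lamL] : exists2 L : nat, (2 <= L)%N & lam <= 2 ^+ L.
  exists (Num.truncn lam).+2 => //; apply: ltW; apply: lt_le_trans (truncnS_gt _) _.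
  by rewrite -natrX ler_nat; apply: leq_trans (ltnW (ltn_expl _ (ltnSn 1))) _; rewrite leq_exp2l.
pose Lam : R := 2 ^+ L.
have Lam4 : 4 <= Lam by rewrite /Lam (_ : 4 = 2 ^+ 2) ?ler_eXn2l ?ltr1n//; ring.
have Lam0 : 0 < Lam by rewrite exprn_gt0.
have D0 : 0 < D by exact: lt_trans D1.
pose beta := p0^-1 - p^-1.
pose tau := (1 - (D ^+ 4)^-1) `^ beta.
pose K := D ^+ L * Cp * ((D ^+ L) `^ beta) * (3 / (1 - tau)) * 4.
have tau1 : 0 < 1 - tau.
  have D4 : 1 < D ^+ 4 by rewrite exprn_egt1.
  have D40 : 0 < D ^+ 4 by exact: lt_trans D4.
  have t0 : 0 <= 1 - (D ^+ 4)^-1 by rewrite subr_ge0 invf_le1// ltW.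
  have b0 : 0 < beta by rewrite subr_gt0 ltf_pV2 ?posrE// (lt_le_trans ltr01 p01).
  rewrite subr_gt0 /tau -[ltRHS](_ : 1 `^ beta = 1); last by rewrite powR1.
  apply: gt0_ltr_powR; rewrite ?nnegrE//.
  by rewrite ltrBlDr ltrDl invr_gt0.
have K0 : 0 < K.
  rewrite /K mulr_gt0// mulr_gt0 ?divr_gt0// mulr_gt0 ?powR_gt0 ?exprn_gt0//.
  by rewrite mulr_gt0 ?exprn_gt0// (lt_le_trans ltr01 Cp1).
(* The factors stem from radii beyond [R'], from comparing the number of scales with the logarithm,
   and from the chain estimate. *)
pose C := (Lam ^+ 2) `^ p * 6 `^ (p - 1) * (K / (D ^+ 4)^-1) `^ p.
have C0 : 0 < C.
  by rewrite !mulr_gt0// powR_gt0// ?exprn_gt0// divr_gt0// invr_gt0 exprn_gt0.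
exists C; split=> // r R' A u h r0 rR RR0 A0 HA meas_u u01 u1 u0 ug h_off.
have R'0 : 0 < R' by apply: lt_le_trans rR; rewrite mulr_gt0.
have h0 y : (0 <= h y)%E by case: ug.
have [hI|] := ltP (\int[mu]_y (h y `^ p))%E +oo%E; last first.
  by rewrite leye_eq => /eqP ->; rewrite gt0_muley ?leey// lte_fin.
have mh : measurable_fun setT h by case: ug => bh _ _; exact: borel_measurable_fun bh.
have ex : exists n, R' <= Lam ^+ n * r.
  exists (Num.truncn (R' / r)).+1.
  rewrite -ler_pdivrMr//; apply: le_trans (ltW (truncnS_gt _)) _.
  apply: (@le_trans _ _ (2 ^+ (Num.truncn (R' / r)).+1)).
    by rewrite -natrX ler_nat ltnW// ltn_expl.
  apply: lerXn2r; rewrite ?nnegrE// ?(ltW Lam0)//.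
  by apply: le_trans Lam4; rewrite ler_nat.
have [[|k] HK Kmin] := ex_minnP ex.
  by move: HK; rewrite expr0 mul1r leNgt (lt_le_trans _ rR)// ltr_pMl// ltr1n.
have kmin n : (n < k.+1)%N -> Lam ^+ n * r < R'.
  by move=> nk; rewrite ltNge; apply/negP => /Kmin; rewrite leqNgt nk.
(* The chain reaches radius [Lam ^+ k.+2 * r], which may exceed [R'] by a factor [Lam ^+ 2]; there
   the measure is bounded below by that of the ball of radius [R'], and only the power of the radius
   is lost. *)
pose A' := A / (Lam ^+ 2) `^ p.
have L20 : 0 < Lam ^+ 2 by rewrite exprn_gt0.
have A'0 : 0 < A' by rewrite divr_gt0// powR_gt0.
have Lp1 : 1 <= (Lam ^+ 2) `^ p.
  rewrite -(powRr0 (Lam ^+ 2)); apply: ler_powR; last exact: ltW.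
  by rewrite exprn_ege1// (le_trans _ Lam4)// ler1n.
have A'A : A' <= A by rewrite ler_pdivrMr ?powR_gt0// ler_peMr// ltW.
have rad0 j : 0 < Lam ^+ j * r by rewrite mulr_gt0// exprn_gt0.
have qlow j : (j <= k.+2)%N -> A' <= m (Lam ^+ j * r) / (Lam ^+ j * r) `^ p.
  move=> jk; have [jR|jR] := leP (Lam ^+ j * r) R'.
    apply: le_trans A'A _; apply: HA => //.
    by rewrite ler_peMl ?(ltW r0)// exprn_ege1// (le_trans _ Lam4)// ler1n.
  have radu : Lam ^+ j * r <= Lam ^+ 2 * R'.
    apply: (@le_trans _ _ (Lam ^+ k.+2 * r)).
      rewrite ler_pM2r// ler_weXn2l// (le_trans _ Lam4)// ler1n//.
    have := ltW (kmin k (ltnSn k)); rewrite -(ler_pM2l L20) mulrA -exprD.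
    by rewrite add2n.
  have := HA R' _ (lexx _); rewrite (le_trans _ rR); last by rewrite ler_peMl ?(ltW r0)// ler1n.
  move=> /(_ isT) HAR; rewrite /A' ler_pdivrMr ?powR_gt0//.
  apply: (le_trans HAR).
  rewrite ler_pdivrMr ?powR_gt0// -mulrA -powRM ?(ltW L20) ?(ltW R'0)// mulrAC.
  rewrite ler_pdivlMr ?powR_gt0//.
  apply: ler_pM; rewrite ?powR_ge0 ?(ltW (mball_gt0 _ _ mball _ _ _))//.
    by apply: mball_le => //; exact: ltW.
  apply: ge0_ler_powR; rewrite ?nnegrE; [exact: ltW|exact: ltW| |exact: radu].
  by apply: mulr_ge0; exact: ltW.
pose J := fine (\int[mu]_(y in dball d x (Lam ^+ k.+1 * r)) (h y `^ p))%E.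
have a0 : 0 <= A' `^ (- p^-1) by exact: powR_ge0.
have est := chain_estimate d mu dm mopen mball x z R0 p0 p D Cp lam L p01 p0p far D1
  doub Cp1 lam1 H L2 lamL r R' k.+1 u h r0 R'0 RR0 HK
  (fun n nk => le_trans (ltW (kmin n nk)) RR0) meas_u u01 u1 u0 ug h_off hI (A' `^ (- p^-1)) a0.
have {}est : (D ^+ 4)^-1 <= K * (A' `^ (- p^-1) * (k.+2%:R `^ (1 - p^-1) * J `^ p^-1)).
  apply: est => j jk; have mj := mball_gt0 d mu mball x _ (rad0 j).
  have -> : Lam ^+ j * r * fine (mu (dball d x (Lam ^+ j * r))) `^ (- p^-1) =
      (m (Lam ^+ j * r) / (Lam ^+ j * r) `^ p) `^ (- p^-1).
    rewrite (powRM _ (ltW mj)); last by rewrite invr_ge0 powR_ge0.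
    rewrite [RHS]mulrC; congr (_ * _).
    by rewrite -powRN -powRrM mulrNN divff ?gt_eqF// powRr1//; exact: ltW.
  rewrite !powRN lef_pV2 ?posrE ?powR_gt0//; last by rewrite divr_gt0 ?powR_gt0.
  apply: ge0_ler_powR; rewrite ?nnegrE ?invr_ge0 ?(ltW p_gt0) ?(ltW A'0)//; last exact: qlow.
  by rewrite divr_ge0 ?powR_ge0// ltW.
have J0 : 0 <= J.
  by apply: fine_ge0; apply: integral_ge0 => y _; exact: poweR_ge0.
have JI : (J%:E <= \int[mu]_y (h y `^ p))%E.
  rewrite fineK; last by apply: integral_pow_fin => //; exact: dball_measurable.
  apply: ge0_subset_integral => //; first exact: dball_measurable.
    exact: measurable_pow.
  by move=> y _; exact: poweR_ge0.
have k0 : 0 < k.+2%:R :> R by rewrite ltr0n.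
have Di : 0 < (D ^+ 4)^-1 by rewrite invr_gt0 exprn_gt0.
have est2 := chain_estimate_pow _ _ _ _ _ _ p1 Di K0 A'0 k0 J0 est.
have ln2 : 2^-1 <= ln (R' / r).
  apply: le_trans ln2_ge_half _.
  by rewrite ler_ln ?posrE ?divr_gt0// ler_pdivlMr.
(* Both [k / 2] and 1/2 are at most the logarithm, so [k] costs twice it and the remaining 2 four
   times it. *)
have lnk : k.+2%:R <= 6 * ln (R' / r).
  have : k%:R * 2^-1 <= ln (R' / r).
    have h1 : ln (2 ^+ k) <= ln (R' / r).
      rewrite ler_ln ?posrE ?divr_gt0 ?exprn_gt0// ler_pdivlMr//.
      apply: le_trans (ltW (kmin k (ltnSn k))); rewrite ler_pM2r//.
      apply: lerXn2r; rewrite ?nnegrE ?(ltW Lam0)//.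
      by apply: le_trans Lam4; rewrite ler_nat.
    apply: le_trans h1; rewrite lnXn// -[leRHS]mulr_natl.
    by rewrite ler_wpM2l// ln2_ge_half.
  have -> : k.+2%:R = k%:R + 2 :> R by rewrite -[k.+2]addn2 natrD.
  move: ln2; move: (ln (R' / r)) (k%:R : R) => l kk ? ?; lra.
have ln0 : 0 < ln (R' / r) by apply: lt_le_trans ln2; rewrite invr_gt0.
apply: (@le_trans _ _ (C * J)%:E); last first.
  by rewrite EFinM; apply: lee_wpmul2l => //; rewrite lee_fin ltW.
rewrite lee_fin.
have lnN : ln (R' / r) `^ (1 - p) <= 6 `^ (p - 1) * k.+2%:R `^ (1 - p).
  rewrite (_ : ln (R' / r) `^ (1 - p) = 6 `^ (p - 1) * (6 * ln (R' / r)) `^ (1 - p)).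
    rewrite ler_pM2l ?powR_gt0// -(opprB p 1) !powRN lef_pV2 ?posrE ?powR_gt0 ?mulr_gt0//.
    by apply: ge0_ler_powR; rewrite ?nnegrE ?subr_ge0 ?(ltW p1) ?mulr_ge0 ?(ltW ln0)//.
  rewrite powRM ?(ltW ln0)// mulrA -powRD; last by rewrite pnatr_eq0 implybT.
  by rewrite (_ : p - 1 + (1 - p) = 0) ?powRr0 ?mul1r//; ring.
have := ler_wpM2l (ltW A0) lnN => /le_trans; apply.
have AE : A = (Lam ^+ 2) `^ p * A' by rewrite /A' mulrC divfK// gt_eqF// powR_gt0.
rewrite {1}AE [leLHS](_ : _ = (Lam ^+ 2) `^ p * 6 `^ (p - 1) * (A' * k.+2%:R `^ (1 - p))); last by ring.
by rewrite /C -[leRHS]mulrA ler_pM2l// mulr_gt0 ?powR_gt0.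
Qed.

End LowerBound.

(** * From weak upper gradients to the capacity *)

Section CapacityLower.
Context {R : realType} {dsp : measure_display} {X : measurableType dsp}.
Variables (d : X -> X -> R) (mu : {measure set X -> \bar R}).
Hypothesis dm : is_metric d.
Hypothesis mopen : forall U : set X, d_open d U -> measurable U.

Lemma poweRD_le (p : R) (a b : \bar R) : 0 < p -> (0 <= a)%E -> (0 <= b)%E ->
  ((a + b) `^ p <= (2 `^ p)%:E * (a `^ p + b `^ p))%E.
Proof.
move=> p0; have pn : p != 0 by rewrite gt_eqF.
have c0 : (0 < (2 `^ p)%:E :> \bar R)%E by rewrite lte_fin powR_gt0.
case: a => [a| |] // a0; case: b => [b| |] // b0;
  rewrite ?addye ?addey // ?poweRyr // ?addye ?addey ?gt0_muley ?leey //.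
rewrite !lee_fin in a0 b0.
rewrite -EFinD !poweR_EFin -EFinD -EFinM lee_fin mulrDr -!powRM//.
wlog ab : a b a0 b0 / a <= b.
  move=> W; have [ab|/ltW ba] := leP a b; first exact: W.
  by rewrite addrC [leRHS]addrC; exact: W.
apply: (@le_trans _ _ ((2 * b) `^ p)); last by rewrite lerDr powR_ge0.
by apply: ge0_ler_powR; rewrite ?nnegrE ?(ltW p0) ?addr_ge0 ?mulr_ge0//; lra.
Qed.

Definition trunc01 (t : R) : R := Num.max 0 (Num.min 1 t).

Lemma trunc01_itv t : 0 <= trunc01 t <= 1.
Proof. by rewrite /trunc01 le_max lexx/= ge_max ler01 ge_min lexx. Qed.

Lemma trunc01_lip s t : `|trunc01 s - trunc01 t| <= `|s - t|.
Proof.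
rewrite ler_norml; have := ler_norm (s - t); have := ler_norm (t - s).
rewrite distrC; move: `|s - t| => c h1 h2.
by rewrite /trunc01 /Num.max /Num.min; repeat case: ifPn; rewrite -?leNgt => *; lra.
Qed.

(* Since trunc01 v oscillates by at most 1, adding a function rho admissible
   for the exceptional family turns a weak upper gradient of v into a genuine
   upper gradient of the truncation. *)
Lemma upper_gradient_trunc (p e : R) (v : X -> R) (g : X -> \bar R) : 0 < e ->
  pweak_upper_gradient d mu p v g ->
  exists rho : X -> \bar R, [/\ borel_efun d rho, (forall y, (0 <= rho y)%E),
    (\int[mu]_y (rho y `^ p) <= e%:E)%E &
    upper_gradient d (trunc01 \o v) (g \+ rho)%E].
Proof.
move=> e0 [bg g0 mod0].
have : (modulus d mu p [set c | curves d c /\ ~ ug_ineq v g c] < e%:E)%E.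
  by rewrite mod0 lte_fin.
move=> /ereal_inf_lt [_ [rho [br r0 adm] <-]] re; exists rho; split => //.
  exact: ltW.
split.
- by apply/d_borelP; apply: emeasurable_funD; exact/d_borelP.
- by move=> y; exact: adde_ge0.
move=> c cc; rewrite /ug_ineq line_intE ge0_integralD//; last 2 first.
  exact: (borel_comp_curve _ dm _ _ bg cc).
  exact: (borel_comp_curve _ dm _ _ br cc).
rewrite -!line_intE; have [ok|bad] := pselect (ug_ineq v g c).
  apply: le_trans (leeDl _ _); last by rewrite line_intE; exact: integral_ge0.
  by apply: le_trans ok; rewrite lee_fin trunc01_lip.
apply: le_trans (leeDr _ _); last by rewrite line_intE; exact: integral_ge0.
apply: le_trans (adm c _); last by split.
rewrite lee_fin ler_norml /=.
have := trunc01_itv (v (c.1 0)); have := trunc01_itv (v (c.1 c.2)); lra.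
Qed.

Hypothesis mball : forall (y : X) (r : R), 0 < r ->
  (0 < mu (dball d y r) < +oo)%E.
Variables (x z : X) (R0 p0 p D : R).
Hypotheses (p01 : 1 <= p0) (p0p : p0 < p).
Hypothesis far : 2 * R0 < d x z.
Hypothesis D1 : 1 < D.
Hypothesis doub : forall y (r : R), 0 < r ->
    (mu (dball d y (2 * r)) <= D%:E * mu (dball d y r))%E.
Hypothesis poin : global_poincare d mu p0.

Lemma capacity_lower_bound : exists C : R, 0 < C /\
  forall r R' A : R, 0 < r -> 2 * r <= R' -> R' <= R0 -> 0 < A ->
  (forall rho : R, r <= rho -> rho <= R' -> A <= fine (mu (dball d x rho)) / rho `^ p) ->
  ((A * ln (R' / r) `^ (1 - p))%:E <=
    C%:E * capacity d mu p (dball d x r) (dball d x R'))%E.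
Proof.
have p_gt0 : 0 < p by apply: lt_trans p0p; exact: lt_le_trans p01.
have [C [C0 H]] := energy_lower_bound d mu dm mopen mball x z R0 p0 p D p01 p0p far D1 doub poin.
pose C' := C * 2 `^ p; have C'0 : 0 < C' by rewrite mulr_gt0// powR_gt0.
exists C'; split => // r R' A r0 rR RR0 A0 HA.
have R'0 : 0 < R' by apply: lt_le_trans rR; rewrite mulr_gt0.
rewrite -lee_pdivrMl//; apply: le_ereal_inf_tmp => _ [[v g] [[mv _ _] /= v0 v1 wg] <-].
rewrite lee_pdivrMl//; set Gp := (\int[mu]_(y in _) _)%E.
apply/lee_addgt0Pr => e e0.
(* The energy of the correction [rho] is multiplied by [C'] in the end, which leaves the error
   [e]. *)
have e0' : 0 < e / C' by rewrite divr_gt0.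
have [rho [br r0' re ug]] := upper_gradient_trunc p (e / C') v g e0' wg.
have [bg g0 _] := wg.
set B := dball d x R'.
have oB : d_open d B by exact: dball_open.
have mB : measurable B by exact: mopen.
have t0 y : ~ B y -> (trunc01 \o v) y = 0.
  by move=> /v0 /= ->; rewrite /trunc01 min_r// max_l.
have ugc : upper_gradient d (trunc01 \o v) ((g \+ rho)%E \_ B).
  apply: upper_gradient_cutoff => // y; by case/andP: (trunc01_itv (v y)).
have := H r R' A (trunc01 \o v) ((g \+ rho)%E \_ B) r0 rR RR0 A0 HA.
have mt : measurable_fun setT (trunc01 \o v).
  by apply: measurable_maxr => //; apply: measurable_minr.
move=> /(_ mt (fun y => trunc01_itv (v y))).
have t1 y : dball d x r y -> (trunc01 \o v) y = 1.
  by move=> /v1 h; rewrite /= /trunc01 min_l ?max_r.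
have off y : ~ B y -> ((g \+ rho)%E \_ B) y = 0%E.
  by move=> By; rewrite patchN//; apply/negP; rewrite inE.
move=> /(_ t1 t0 ugc off) /le_trans; apply.
have mg := borel_measurable_fun d mopen _ bg.
have mr := borel_measurable_fun d mopen _ br.
have I1 : (\int[mu]_y (((g \+ rho)%E \_ B) y `^ p) <=
    (2 `^ p)%:E * (Gp + (e / C')%:E))%E.
  have -> : (\int[mu]_y (((g \+ rho)%E \_ B) y `^ p) =
     \int[mu]_(y in B) ((g y + rho y) `^ p))%E.
    rewrite [RHS]integral_mkcond; apply: eq_integral => y _; rewrite /patch.
    by case: ifPn => // _; rewrite poweR0r// gt_eqF.
  apply: (@le_trans _ _ (\int[mu]_(y in B)
      ((2 `^ p)%:E * (g y `^ p + rho y `^ p)))%E).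
    apply: ge0_le_integral => //.
    - by move=> y _; exact: poweR_ge0.
    - apply: (measurable_pow (fun y => g y + rho y)%E).
      exact: emeasurable_funD.
    - apply: measurable_funeM; apply: emeasurable_funD; exact: measurable_pow.
    - by move=> y _; exact: poweRD_le.
  rewrite ge0_integralZl_EFin ?powR_ge0//; last 2 first.
  - by move=> y _; rewrite adde_ge0 ?poweR_ge0.
  - by apply: emeasurable_funD; exact: measurable_pow.
  apply: lee_wpmul2l; first by rewrite lee_fin powR_ge0.
  rewrite ge0_integralD//; last 4 first.
  - by move=> y _; exact: poweR_ge0.
  - exact: measurable_pow.
  - by move=> y _; exact: poweR_ge0.
  - exact: measurable_pow.
  apply: leeD => //; apply: le_trans re; apply: ge0_subset_integral => //.
    exact: measurable_pow.
  by move=> y _; exact: poweR_ge0.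
apply: (@le_trans _ _ (C%:E * ((2 `^ p)%:E * (Gp + (e / C')%:E)))%E).
  by apply: lee_wpmul2l => //; rewrite lee_fin ltW.
rewrite muleA -EFinM -/C' muleDr//; last first.
  rewrite ge0_adde_def// inE//; first by apply: integral_ge0 => y _; exact: poweR_ge0.
  by rewrite lee_fin ltW.
by rewrite -EFinM [C' * _]mulrC divfK// gt_eqF.
Qed.

End CapacityLower.

(** * The two-sided estimates *)

Section TwoSided.
Context {R : realType} {dsp : measure_display} {X : measurableType dsp}.
Variables (d : X -> X -> R) (mu : {measure set X -> \bar R}).
Hypothesis dm : is_metric d.
Hypothesis mopen : forall U : set X, d_open d U -> measurable U.
Hypothesis mball : forall (y : X) (r : R), 0 < r ->
  (0 < mu (dball d y r) < +oo)%E.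

Lemma capacity_ge0 p E Om : (0 <= capacity d mu p E Om)%E.
Proof.
by apply: le_ereal_inf_tmp => _ [ug _ <-]; apply: integral_ge0 => y _; exact: poweR_ge0.
Qed.

(** Of two points more than 4 R0 apart, one is more than 2 R0 away from [x]; it serves as the far
    end in the annulus argument. *)
Lemma far_point (x : X) (R0 : R) : ((4 * R0)%:E < diam d)%E ->
  exists z, 2 * R0 < d x z.
Proof.
move=> /ereal_sup_gt[_ [a [b ->]]]; rewrite lte_fin => ab.
case: dm => _ _ ds dt; have := dt a x b; rewrite (ds a x).
have [xa|xa] := ltP (2 * R0) (d x a); first by exists a.
by move=> h; exists b; lra.
Qed.

(** A constant strictly above 1 keeps the reverse doubling factor positive. *)
Lemma doubling_gt1 : globally_doubling d mu -> exists D : R, 1 < D /\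
  forall y (r : R), 0 < r -> (mu (dball d y (2 * r)) <= D%:E * mu (dball d y r))%E.
Proof.
move=> [C H]; exists (Num.max C 2); split; first by rewrite lt_max ltr1n orbT.
move=> y r r0; apply: le_trans (H y r r0) _; apply: lee_wpmul2r => //.
by rewrite lee_fin le_max lexx.
Qed.

Variables (x z : X) (R0 p0 p D : R).
Hypotheses (R0_gt0 : 0 < R0) (p01 : 1 <= p0) (p0p : p0 < p).
Hypothesis far : 2 * R0 < d x z.
Hypothesis D1 : 1 < D.
Hypothesis doub : forall y (r : R), 0 < r ->
    (mu (dball d y (2 * r)) <= D%:E * mu (dball d y r))%E.
Hypothesis poin : global_poincare d mu p0.

Let m r := fine (mu (dball d x r)).
Let q r := m r / r `^ p.
Let p1 : 1 < p. Proof. exact: le_lt_trans p0p. Qed.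
Let p_gt0 : 0 < p. Proof. exact: lt_trans p1. Qed.
Let m_gt0 r : 0 < r -> 0 < m r. Proof. by move=> r0; exact: mball_gt0. Qed.

(** [lo] and [hi] stand for the values of [q] at the two ends of [r, R'], in either order. A tent of
    scale rho has its gradient on radius 2 rho, and passing to [q (2 * rho)] costs the innermost 2^p
    in [K]. *)
Lemma capacity_two_sided (C1 : R) (lo hi : R -> R -> R) : 0 < C1 ->
  (forall r R' : R, 0 < r -> 2 * r <= R' -> R' <= R0 ->
    0 < lo r R' /\ forall rho : R, r <= rho -> rho <= R' ->
      lo r R' <= C1 * q rho /\ q rho <= C1 * hi r R') ->
  exists C : R, 0 < C /\ forall r R' : R, 0 < r -> 2 * r <= R' -> R' <= R0 ->
    ((lo r R' * ln (R' / r) `^ (1 - p))%:E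
        <= C%:E * capacity d mu p (dball d x r) (dball d x R')
     /\ capacity d mu p (dball d x r) (dball d x R')
        <= (C * (hi r R' * ln (R' / r) `^ (1 - p)))%:E)%E.
Proof.
move=> C10 H.
have [C2 [C20 Hl]] := capacity_lower_bound d mu dm mopen mball x z R0 p0 p D
  p01 p0p far D1 doub poin.
pose K := 2 `^ p * 2 `^ p * (2 `^ p * C1).
have K0 : 0 < K by rewrite !mulr_gt0 ?powR_gt0.
exists (C1 * C2 + K); split; first by rewrite addr_gt0// mulr_gt0.
move=> r R' r0 rR RR0; have [lo0 Hq] := H r R' r0 rR RR0.
have R'0 : 0 < R' by apply: lt_le_trans rR; rewrite mulr_gt0.
have rR' : r <= R' by apply: le_trans rR; rewrite ler_peMl ?(ltW r0)// ler1n.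
split.
  apply: (@le_trans _ _ ((C1 * C2)%:E * capacity d mu p (dball d x r) (dball d x R'))%E).
    have A0 : 0 < lo r R' / C1 by rewrite divr_gt0.
    have := Hl r R' (lo r R' / C1) r0 rR RR0 A0.
    have HA (rho : R) : r <= rho -> rho <= R' -> lo r R' / C1 <= q rho.
      by move=> h1 h2; rewrite ler_pdivrMr// mulrC; case: (Hq rho h1 h2).
    move=> /(_ HA) hh.
    have C1E : (0 <= C1%:E :> \bar R)%E by rewrite lee_fin ltW.
    have := lee_wpmul2l C1E hh; rewrite muleA -!EFinM; apply: le_trans.
    by rewrite lee_fin mulrA [C1 * _]mulrC divfK// gt_eqF.
  apply: lee_wpmul2r; first exact: capacity_ge0.
  by rewrite lee_fin lerDl ltW.
have hi0 : 0 <= hi r R'.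
  have [_] := Hq r (lexx _) rR' => /(le_trans _) h.
  have : 0 <= C1 * hi r R' by apply: h; rewrite divr_ge0 ?powR_ge0// ltW// m_gt0.
  by rewrite pmulr_rge0.
apply: (@le_trans _ _ (K * (hi r R' * ln (R' / r) `^ (1 - p)))%:E); last first.
  rewrite lee_fin ler_wpM2r ?mulr_ge0 ?powR_ge0// lerDr.
  by apply: mulr_ge0; exact: ltW.
have := capacity_le_log d mu dm mopen x mball p r R' (2 `^ p * C1 * hi r R') p1 r0 rR.
have Hup (rho : R) : r <= rho -> 2 * rho <= R' ->
    fine (mu (dball d x (2 * rho))) / rho `^ p <= 2 `^ p * C1 * hi r R'.
  move=> h1 h2; have rho0 : 0 < rho by exact: lt_le_trans h1.
  have -> : fine (mu (dball d x (2 * rho))) / rho `^ p = 2 `^ p * q (2 * rho).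
    rewrite /q /m powRM ?(ltW rho0)//; field.
    by rewrite !gt_eqF ?powR_gt0.
  rewrite -mulrA ler_pM2l ?powR_gt0//.
  by case: (Hq (2 * rho) _ h2) => //; apply: le_trans h1 _; rewrite ler_peMl ?(ltW rho0)// ler1n.
move=> /(_ Hup) /le_trans; apply.
by rewrite lee_fin le_eqVlt; apply/orP; left; apply/eqP; rewrite /K; ring.
Qed.

(** * From capacity bounds back to exponents *)

Lemma absorb_log (b : R) : 0 < b -> exists C : R, 0 < C /\
  forall t U V : R, 2 <= t -> 0 <= V -> U * ln t `^ (1 - p) <= V -> U <= C * V * t `^ b.
Proof.
move=> b0; have p10 : 0 < p - 1 by rewrite subr_gt0.
have [C [C0 H]] := ln_powR_le (p - 1) b p10 b0.
exists C; split => // t U V t2 V0.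
have t1 : 1 <= t by apply: le_trans t2; rewrite ler1n.
have ln0 : 0 < ln t by rewrite ln_gt0// (lt_le_trans _ t2)// ltr1n.
rewrite -(opprB p 1) powRN ler_pdivrMr ?powR_gt0// => /le_trans; apply.
by rewrite [C * V]mulrC -mulrA; apply: ler_wpM2l => //; exact: H.
Qed.

(** A single tent of scale R'/2; the second 2^p comes from replacing R'/2 by [R'] in the power. *)
Lemma capacity_le_outer (r R' : R) : 0 < r -> 2 * r <= R' ->
  (capacity d mu p (dball d x r) (dball d x R') <= (2 `^ p * (2 `^ p * q R'))%:E)%E.
Proof.
move=> r0 rR.
have R'0 : 0 < R' by apply: lt_le_trans rR; rewrite mulr_gt0.
have h0 : 0 < R' / 2 by rewrite divr_gt0.
have h2 : 2 * (R' / 2) = R' by field.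
have := capacity_le_dyadic d mu dm mopen x mball p 1 (R' / 2) (2 `^ p * q R')
  (dball d x r) (dball d x R') p1 isT h0.
rewrite powR1 mulr1 expr1 h2; apply => //.
- by move=> y /lt_le_trans; apply; lra.
- exact: dball_measurable.
- move=> j; rewrite ltnS leqn0 => /eqP ->; rewrite expr0 mul1r h2 -/(m _) /q.
  have -> : R' `^ p = 2 `^ p * (R' / 2) `^ p by rewrite -powRM ?(ltW h0)// h2.
  rewrite le_eqVlt; apply/orP; left; apply/eqP; field.
  by rewrite !gt_eqF ?powR_gt0.
Qed.

(** A single tent of scale [r]; doubling reduces its support to the ball of radius [r]. *)
Lemma capacity_le_inner (r R' : R) : 0 < r -> 2 * r <= R' ->
  (capacity d mu p (dball d x r) (dball d x R') <= (2 `^ p * (D * q r))%:E)%E.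
Proof.
move=> r0 rR.
have := capacity_le_dyadic d mu dm mopen x mball p 1 r (D * q r)
  (dball d x r) (dball d x R') p1 isT r0.
rewrite powR1 mulr1 expr1; apply => //.
- exact: dball_measurable.
- by move=> y /lt_le_trans; apply.
- move=> j; rewrite ltnS leqn0 => /eqP ->; rewrite expr0 mul1r /q mulrA.
  rewrite ler_pM2r ?invr_gt0 ?powR_gt0//.
  by have := doubling_iter d mu mball D (ltW D1) doub x r 1 r0; rewrite !expr1.
Qed.

Let divpow r R' (e : R) : 0 < r -> 0 < R' -> (r / R') `^ e = r `^ e / R' `^ e.
Proof.
move=> r0 R'0; rewrite powRM ?invr_ge0 ?(ltW r0) ?(ltW R'0)//.
by rewrite -(powR_inv1 (ltW R'0)) -powRrM mulN1r powRN.
Qed.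

Let powVK r R' (e1 e2 : R) : 0 < r -> 0 < R' ->
  (r / R') `^ e1 * (R' / r) `^ e2 = (r / R') `^ (e1 - e2).
Proof.
move=> r0 R'0; have t0 : 0 < r / R' by rewrite divr_gt0.
rewrite powRD; last by rewrite (gt_eqF t0) implybT.
congr (_ * _); rewrite -mulN1r powRrM powR_inv1 ?(ltW t0)//.
by rewrite invf_div.
Qed.

(** Together with the outer bound, the hypothesis controls the ratio of measures by (r/R')^p up to a
    logarithm. Giving up [p - e] in the exponent absorbs it, so every positive exponent below [p] is
    reached. *)
Lemma Qlow_of_capacity (C e : R) : 0 < C -> 0 < e -> e < p ->
  (forall r R' : R, 0 < r -> 2 * r <= R' -> R' <= R0 ->
    ((q r * ln (R' / r) `^ (1 - p))%:E <=
      C%:E * capacity d mu p (dball d x r) (dball d x R'))%E) ->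
  Qlow d mu x e.
Proof.
move=> C0 e0 ep H; have b0 : 0 < p - e by rewrite subr_gt0.
have [C5 [C50 Habs]] := absorb_log _ b0.
pose K := C * (2 `^ p * 2 `^ p); have K0 : 0 < K by rewrite !mulr_gt0 ?powR_gt0.
have CE : (0 <= C%:E :> \bar R)%E by rewrite lee_fin ltW.
apply: (Qlow_of_annuli d mu dm mopen mball x R0 R0_gt0 e e0 (C5 * K)).
  by rewrite mulr_gt0.
move=> r R' r0 rR RR0; have R'0 : 0 < R' by apply: lt_le_trans rR; rewrite mulr_gt0.
have := le_trans (H r R' r0 rR RR0) (lee_wpmul2l CE (capacity_le_outer _ _ r0 rR)).
rewrite -EFinM lee_fin => hh.
have t2 : 2 <= R' / r by rewrite ler_pdivlMr.
have V0 : 0 <= K * (r / R') `^ p by rewrite mulr_ge0 ?powR_ge0 ?(ltW K0).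
have := Habs (R' / r) (m r / m R') (K * (r / R') `^ p) t2 V0.
rewrite -[C5 * _ * _]mulrA -[K * _ * _]mulrA powVK// (_ : p - (p - e) = e); last by ring.
rewrite mulrA; apply.
rewrite mulrAC ler_pdivrMr ?m_gt0//.
have rp := powR_gt0 p r0; have Rp := powR_gt0 p R'0.
rewrite divpow// (_ : _ * m R' = C * (2 `^ p * (2 `^ p * q R')) * r `^ p); last first.
  by rewrite /K /q; ring.
rewrite -ler_pdivrMr//; apply: le_trans hh.
by rewrite /q le_eqVlt; apply/orP; left; apply/eqP; ring.
Qed.

Lemma Qup_of_capacity (C e : R) : 0 < C -> p < e ->
  (forall r R' : R, 0 < r -> 2 * r <= R' -> R' <= R0 ->
    ((q R' * ln (R' / r) `^ (1 - p))%:E <=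
      C%:E * capacity d mu p (dball d x r) (dball d x R'))%E) ->
  Qup d mu x e.
Proof.
move=> C0 pe H; have b0 : 0 < e - p by rewrite subr_gt0.
have e0 : 0 < e by exact: lt_trans pe.
have [C5 [C50 Habs]] := absorb_log _ b0.
have D0 : 0 < D by exact: lt_trans D1.
pose K := C * (2 `^ p * D); have K0 : 0 < K by rewrite !mulr_gt0 ?powR_gt0.
have CE : (0 <= C%:E :> \bar R)%E by rewrite lee_fin ltW.
have CK : 0 < C5 * K by rewrite mulr_gt0.
apply: (Qup_of_annuli d mu dm mopen mball x R0 D R0_gt0 (ltW D1) doub e e0 (C5 * K)^-1).
  by rewrite invr_gt0.
move=> r R' r0 rR RR0; have R'0 : 0 < R' by apply: lt_le_trans rR; rewrite mulr_gt0.
have := le_trans (H r R' r0 rR RR0) (lee_wpmul2l CE (capacity_le_inner _ _ r0 rR)).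
rewrite -EFinM lee_fin => hh.
have t2 : 2 <= R' / r by rewrite ler_pdivlMr.
have V0 : 0 <= K * (m r / m R').
  by rewrite mulr_ge0 ?divr_ge0 ?(ltW K0) ?(ltW (m_gt0 _ _)).
have rp := powR_gt0 p r0; have Rp := powR_gt0 p R'0.
have U0 : (r / R') `^ p * ln (R' / r) `^ (1 - p) <= K * (m r / m R').
  rewrite divpow// mulrA ler_pdivlMr ?m_gt0//.
  rewrite (_ : _ * m R' = q R' * ln (R' / r) `^ (1 - p) * r `^ p); last by rewrite /q; ring.
  rewrite -ler_pdivlMr//; apply: (le_trans hh).
  by rewrite /K /q le_eqVlt; apply/orP; left; apply/eqP; ring.
have {}U0 := Habs _ _ _ t2 V0 U0.
rewrite mulrC ler_pdivrMr//.
have := ler_wpM2r (powR_ge0 (r / R') (e - p)) U0.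
have -> : C5 * (K * (m r / m R')) * (R' / r) `^ (e - p) * (r / R') `^ (e - p) =
    m r / m R' * (C5 * K).
  rewrite -mulrA [(R' / r) `^ _ * _]mulrC powVK// subrr powRr0; ring.
rewrite -powRD; last by rewrite (gt_eqF (divr_gt0 r0 R'0)) implybT.
by rewrite addrC subrK.
Qed.

End TwoSided.

Theorem theorem1p2 (R : realType) (dsp : measure_display) (X : measurableType dsp)
  (d : X -> X -> R) (mu : {measure set X -> \bar R}) (x : X) (R0 p p0 : R) :
  is_metric d ->
  (forall U : set X, d_open d U -> measurable U) ->
  measure_is_complete mu ->
  (forall (y : X) (r : R), 0 < r -> (0 < mu (dball d y r) < +oo)%E) ->
  0 < R0 -> ((4 * R0)%:E < diam d)%E ->
  1 < p ->
  globally_doubling d mu ->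
  1 <= p0 -> p0 < p -> global_poincare d mu p0 ->
  let B := dball d x in
  let logt (r R' : R) := ln (R' / r) `^ (1 - p) in
  [/\
   (* (i) *)
   (Qlow d mu x p /\ (forall q, Qlow d mu x q -> q <= p)) ->
     exists C : R, 0 < C /\ forall r R' : R, 0 < r -> 2 * r <= R' -> R' <= R0 ->
       ((fine (mu (B r)) / r `^ p * logt r R')%:E
           <= C%:E * capacity d mu p (B r) (B R')
        /\ capacity d mu p (B r) (B R')
           <= (C * (fine (mu (B R')) / R' `^ p * logt r R'))%:E)%E,
   (* (ii) *)
   (Qup d mu x p /\ (forall q, Qup d mu x q -> p <= q)) ->
     exists C : R, 0 < C /\ forall r R' : R, 0 < r -> 2 * r <= R' -> R' <= R0 ->
       ((fine (mu (B R')) / R' `^ p * logt r R')%:E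
           <= C%:E * capacity d mu p (B r) (B R')
        /\ capacity d mu p (B r) (B R')
           <= (C * (fine (mu (B r)) / r `^ p * logt r R'))%:E)%E,
   (* lower bound of (i) for all r, R' forces p <= sup Qlow *)
   (exists C : R, 0 < C /\ forall r R' : R, 0 < r -> 2 * r <= R' -> R' <= R0 ->
       ((fine (mu (B r)) / r `^ p * logt r R')%:E
           <= C%:E * capacity d mu p (B r) (B R'))%E) ->
     (p%:E <= ereal_sup [set q%:E | q in Qlow d mu x])%E &
   (* lower bound of (ii) for all r, R' forces p >= inf Qup *)
   (exists C : R, 0 < C /\ forall r R' : R, 0 < r -> 2 * r <= R' -> R' <= R0 ->
       ((fine (mu (B R')) / R' `^ p * logt r R')%:E
           <= C%:E * capacity d mu p (B r) (B R'))%E) ->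
     (ereal_inf [set q%:E | q in Qup d mu x] <= p%:E)%E].
Proof.
move=> dm mopen _ mball R0_gt0 diamR p1 dbl p01 p0p poin B logt.
have p_gt0 : 0 < p by exact: lt_trans p1.
have [z far] := far_point d dm x R0 diamR.
have [D [D1 doub]] := doubling_gt1 d mu dbl.
pose q r := fine (mu (B r)) / r `^ p.
have q_gt0 r : 0 < r -> 0 < q r.
  by move=> r0; rewrite divr_gt0 ?powR_gt0 ?mball_gt0.
have two_sided := capacity_two_sided d mu dm mopen mball x z R0 p0 p D p01 p0p
  far D1 doub poin.
split.
(* Membership in [Qlow] makes [q] almost increasing: [lo] is its value at [r], [hi] its value at
   [R']. *)
- move=> [Hp _]; have [C1 [C10 H]] := Qlow_ext d mu dm mopen mball x p p_gt0 R0 R0_gt0 Hp.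
  apply: (two_sided C1 (fun r _ => q r) (fun _ R' => q R') C10) => r R' r0 rR RR0.
  split; first exact: q_gt0.
  move=> rho h1 h2; have rho0 : 0 < rho by exact: lt_le_trans h1.
  by split; apply: H => //; exact: le_trans h2 RR0.
(* Now [q] is almost decreasing and the two ends exchange their roles. *)
- move=> [Hp _]; have [C1 [C10 H]] := Qup_ext d mu dm mopen mball x p p_gt0 R0 R0_gt0 Hp.
  apply: (two_sided C1 (fun _ R' => q R') (fun r _ => q r) C10) => r R' r0 rR RR0.
  split; first by apply: q_gt0; apply: lt_le_trans rR; rewrite mulr_gt0.
  move=> rho h1 h2; have rho0 : 0 < rho by exact: lt_le_trans h1.
  by split; apply: H => //; exact: le_trans h2 RR0.
- move=> [C [C0 H]]; apply/lee_addgt0Pr => e e0.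
  (* Exponents in [Qlow] are positive, so p - e is replaced by p/2 when [e] is large. *)
  pose b := Num.max (p - e) (p / 2).
  have b0 : 0 < b by rewrite lt_max divr_gt0 ?orbT.
  have bp : b < p by rewrite gt_max gtrBl e0/= ltr_pdivrMr// ltr_pMr// ltr1n.
  have Hb := Qlow_of_capacity d mu dm mopen mball x R0 p0 p R0_gt0 p01 p0p C b C0 b0 bp H.
  apply: (@le_trans _ _ (b%:E + e%:E)%E).
    by rewrite -EFinD lee_fin -lerBlDr le_max lexx.
  by apply: leeD => //; apply: ereal_sup_ubound; exists b.
- move=> [C [C0 H]]; apply/lee_addgt0Pr => e e0.
  have pe : p < p + e by rewrite ltrDl.
  have Hb := Qup_of_capacity d mu dm mopen mball x R0 p0 p D R0_gt0 p01 p0p D1 doub C _ C0 pe H.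
  by rewrite -EFinD; apply: ereal_inf_lbound; exists (p + e).
Qed.
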